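(* Let $2\le k\le\omega$. The effective Wadge hierarchies $\{\Sigma(\mathcal N,T)\}_{T\in\mathcal T_\omega(\bar k)}$ and $\{\Sigma(\mathcal C,T)\}_{T\in\mathcal T_\omega(\bar k)}$ of $k$-partitions of the Baire space $\mathcal N=\omega^\omega$ and of the Cantor space $\mathcal C=2^\omega$ strongly uniformly do not collapse; i.e., for $X\in\{\mathcal N,\mathcal C\}$ and every $T\in\mathcal T_\omega(\bar k)$, $\Sigma(X,T)\not\subseteq\bigcup\{\mathbf\Sigma(X,V)\mid V\in\mathcal T_\omega(\bar k),\ T\not\le_hV\}$.
   Context: $\mathcal N$ and $\mathcal C$ carry their standard effective bases of cylinders. Effective cb$_0$-space: countably based $T_0$ space $X$ with a numbering $\beta$ of a base such that $\beta(i)\cap\beta(j)=\bigcup\beta(A_{ij})$, $A_{ij}$ uniformly c.e.; $\Sigma^0_1(X)$ = sets $\bigcup\beta(W)$, $W$ c.e.; $\{\Sigma^0_{1+n}(X)\}$ the effective Borel hierarchy; $\mathbf\Sigma^0_{1+n}(X)$ the boldface Borel hierarchy. Trees: $\bar k=\{i<k\}$ antichain; finite normal tree = finite nonempty prefix-closed $T\subseteq\omega^*$ with $\tau(i+1)\in T\Rightarrow\tau i\in T$. For a preorder $Q$, a $Q$-tree $(T,t)$, $t:T\to Q$; $(T,t)\le_h(V,v)$ iff a $\sqsubseteq$-monotone $f:T\to V$ has $t(\tau)\le_Qv(f(\tau))$ for all $\tau$. $\mathcal T_0(\bar k)=\bar k$, $\mathcal T_{m+1}(\bar k)$ = $\mathcal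 T_m(\bar k)$-trees; $g_0(i)=(\{\varepsilon\},i)$, $g_{m+1}(T,t)=(T,g_m\circ t)$, $g_{m,p}$ compositions; $\mathcal T_\omega(\bar k)=\bigsqcup_m\mathcal T_m(\bar k)$, $T\le_hV$ iff $g_{m,p}(T)\le_hg_{n,p}(V)$, $p=\max(m,n)$. Hierarchy: for $Y\subseteq X$, $\mathcal L^n_j(Y)=\{Y\cap S:S\in\Sigma^0_{1+n+j}(X)\}$. A $T$-family in $\mathcal L^n(Y)$: for $T=i$ it is $\{Y\}$, determining the constant partition $i$; for $(T,t)\in\mathcal T_{m+1}(\bar k)$ it is $(\{U_\tau\},\{F_\tau\})_{\tau\in T}$ with $U_\tau\in\mathcal L^n_0(Y)$, $U_\varepsilon=Y$, $U_\tau\supseteq U_{\tau'}$ for $\tau\sqsubseteq\tau'$, $F_\tau$ a $t(\tau)$-family in $\mathcal L^{n+1}(\tilde U_\tau)$, $\tilde U_\tau=U_\tau\setminus\bigcup_{\tau\sqsubset\tau'\in T}U_{\tau'}$; it determines $A:Y\to\bar k$ with $A|_{\tilde U_\tau}$ determined by $F_\tau$. $\Sigma(X,T)$: $A:X\to\bar k$ determined by some $T$-family in $\mathcal L^0(X)$. $\mathbf\Sigma(X,T)$: same with boldface classes $\mathbf\Sigma^0_{1+n}(X)$. *)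

(* Defs.v *)
From HB Require Import structures.
From mathcomp Require Import all_boot.
From mathcomp Require Import finmap.
From mathcomp Require Import boolp classical_sets topology cantor.

Set Implicit Arguments.
Unset Strict Implicit.
Unset Printing Implicit Defensive.

Local Open Scope classical_set_scope.

(* [prec_graph f g m v y]: the function h with h(0, v) = f(v) and
   h(m + 1, v) = g(m, h(m, v), v) is defined at (m, v), with value y. *)
Fixpoint prec_graph n (f : n.-tuple nat -> nat -> Prop)
    (g : n.+2.-tuple nat -> nat -> Prop) (m : nat)
    (v : n.-tuple nat) (y : nat) : Prop :=
  match m with
  | 0 => f v y
  | m'.+1 => exists2 z, prec_graph f g m' v z & g [tuple of m' :: z :: v] y
  end.

(* Partial functions are represented by their graphs. *)
Inductive partial_recursive :
    forall n, (n.-tuple nat -> nat -> Prop) -> Prop :=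
| PR_zero n : partial_recursive (fun (_ : n.-tuple nat) y => y = 0)
| PR_succ : partial_recursive (fun (v : 1.-tuple nat) y => y = (thead v).+1)
| PR_proj n (i : 'I_n) :
    partial_recursive (fun (v : n.-tuple nat) y => y = tnth v i)
| PR_comp m n (f : m.-tuple nat -> nat -> Prop)
    (g : 'I_m -> n.-tuple nat -> nat -> Prop) :
    partial_recursive f -> (forall i, partial_recursive (g i)) ->
    partial_recursive (fun (v : n.-tuple nat) y =>
      exists2 w : m.-tuple nat, forall i, g i v (tnth w i) & f w y)
| PR_prec n (f : n.-tuple nat -> nat -> Prop)
    (g : n.+2.-tuple nat -> nat -> Prop) :
    partial_recursive f -> partial_recursive g ->
    partial_recursive (fun (v : n.+1.-tuple nat) y =>
      prec_graph f g (thead v) [tuple of behead v] y)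
| PR_mu n (f : n.+1.-tuple nat -> nat -> Prop) :
    partial_recursive f ->
    partial_recursive (fun (v : n.-tuple nat) y =>
      f [tuple of y :: v] 0 /\
      forall z, z < y -> exists u, f [tuple of z :: v] u.+1).

Definition ce n (W : n.-tuple nat -> Prop) : Prop :=
  exists2 f : n.-tuple nat -> nat -> Prop, partial_recursive f &
    forall v, W v <-> exists y, f v y.

(* Below, the index n stands for the level Sigma^0_(1+n), lightface for
   [unif_sigma0] and [eff_sigma0], boldface for [bold_sigma0].  Index n + 1 is
   given by (effective) countable unions of differences of sets of index n,
   the definition adapted to countably based T0 spaces; on the Baire and
   Cantor spaces it agrees with (effective) countable unions of complements
   of sets of index n. *)

(* [unif_sigma0 beta n A]: the sets A v, for v an r-tuple of naturals, are
   Sigma^0_(1+n) uniformly in v, for the numbering beta of a base of X. *)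
Fixpoint unif_sigma0 X (beta : nat -> set X) (n : nat) :
    forall r, (r.-tuple nat -> set X) -> Prop :=
  match n with
  | 0 => fun r A =>
      exists2 W : r.+1.-tuple nat -> Prop, ce W &
        forall v, A v = \bigcup_(j in [set j | W [tuple of j :: v]]) beta j
  | n'.+1 => fun r A =>
      exists F G : r.+1.-tuple nat -> set X,
        [/\ unif_sigma0 beta n' F, unif_sigma0 beta n' G &
            forall v, A v = \bigcup_j (F [tuple of j :: v] `\`
                                       G [tuple of j :: v])]
  end.

Definition eff_sigma0 X (beta : nat -> set X) (n : nat) : set (set X) :=
  [set S | unif_sigma0 beta n (fun _ : 0.-tuple nat => S)].

Fixpoint bold_sigma0 (X : topologicalType) (n : nat) : set (set X) :=
  match n with
  | 0 => [set S | open S]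
  | n'.+1 => [set S | exists F G : nat -> set X,
      [/\ forall j, bold_sigma0 n' (F j), forall j, bold_sigma0 n' (G j) &
          S = \bigcup_j (F j `\` G j)]]
  end.

Definition baire_space : Type := prod_topology (fun _ : nat => nat).
HB.instance Definition _ := Pointed.on baire_space.
HB.instance Definition _ := Nbhs.on baire_space.
HB.instance Definition _ := Topological.on baire_space.
HB.instance Definition _ := Uniform.on baire_space.

Definition cylinder (A : Type) (s : seq A) : set (nat -> A) :=
  [set x | mkseq x (size s) = s].

(* [CodeSeq.decode] is a computable bijection from nat onto seq nat. *)
Definition baire_base (i : nat) : set baire_space :=
  cylinder (CodeSeq.decode i).

(* The numbering of binary strings is not injective: it reads the parities
   of the entries of the i-th string of naturals. *)
Definition cantor_base (i : nat) : set cantor_space :=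
  cylinder (map odd (CodeSeq.decode i)).

(* [None] stands for omega. *)
Definition kbar (k : option nat) : Type :=
  if k is Some n then 'I_n else nat.

Record qtree (Q : Type) := QTree {
  dom : {fset seq nat};
  dom_neq0 : dom != fset0;
  dom_prefix : forall s s', prefix s s' -> s' \in dom -> s \in dom;
  dom_normal : forall s i, rcons s i.+1 \in dom -> rcons s i \in dom;
  label : dom -> Q }.

Definition qtree_le (Q : Type) (leQ : Q -> Q -> Prop) (T V : qtree Q) : Prop :=
  exists f : dom T -> dom V,
    (forall s s', prefix (val s) (val s') -> prefix (val (f s)) (val (f s')))
    /\ (forall s, leQ (label s) (label (f s))).

Definition qtree_map (Q Q' : Type) (g : Q -> Q') (T : qtree Q) : qtree Q' :=
  QTree (dom_neq0 T) (@dom_prefix _ T) (@dom_normal _ T) (fun s => g (label s)).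

Section Singleton.
Local Open Scope fset_scope.

Lemma root_neq0 : [fset [::] : seq nat] != fset0.
Proof. by apply/fset0Pn; exists [::]; rewrite inE. Qed.

Lemma root_prefix (s s' : seq nat) :
  prefix s s' -> s' \in [fset [::]] -> s \in [fset [::]].
Proof. by move=> + /fset1P s'0; rewrite s'0 prefixs0 inE. Qed.

Lemma root_normal (s : seq nat) (i : nat) :
  rcons s i.+1 \in [fset [::]] -> rcons s i \in [fset [::]].
Proof. by move=> /fset1P; case: s. Qed.

Definition qtree_root (Q : Type) (q : Q) : qtree Q :=
  QTree root_neq0 root_prefix root_normal (fun _ => q).

End Singleton.

Fixpoint itree (k : option nat) (m : nat) : Type :=
  if m is m'.+1 then qtree (itree k m') else kbar k.

Fixpoint itree_le (k : option nat) (m : nat) :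
    itree k m -> itree k m -> Prop :=
  match m with
  | 0 => fun i j => i = j
  | m'.+1 => qtree_le (@itree_le k m')
  end.

Fixpoint itree_up (k : option nat) (m : nat) : itree k m -> itree k m.+1 :=
  match m with
  | 0 => fun i => qtree_root i
  | m'.+1 => fun T => qtree_map (@itree_up k m') T
  end.

Fixpoint itree_lift (k : option nat) (d m : nat) (T : itree k m) :
    itree k (d + m) :=
  match d with
  | 0 => T
  | d'.+1 => itree_up (itree_lift d' T)
  end.

(* The cast only identifies the levels p - m + m and p. *)
Definition itree_emb (k : option nat) (m p : nat) (le_mp : m <= p)
    (T : itree k m) : itree k p :=
  eq_rect (p - m + m) (itree k) (itree_lift (p - m) T) p (subnK le_mp).

Definition tree_omega (k : option nat) : Type := {m : nat & itree k m}.

Definition tree_le (k : option nat) (T V : tree_omega k) : Prop :=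
  itree_le (itree_emb (leq_maxl (tag T) (tag V)) (tagged T))
           (itree_emb (leq_maxr (tag T) (tag V)) (tagged V)).

(* The data of a T-family; when T is a color i, the family {Y} carries no data
   besides the ambient set Y, which is an argument of the predicates below. *)
Fixpoint family (X : Type) (k : option nat) (m : nat) : itree k m -> Type :=
  match m with
  | 0 => fun _ => unit
  | m'.+1 => fun T =>
      ((dom T -> set X) * (forall s : dom T, family X (label s)))%type
  end.

(* U~_s, the part of U_s outside of all U_s' with s' a proper extension of s. *)
Definition tilde (X : Type) (D : {fset seq nat}) (U : D -> set X) (s : D) :
    set X :=
  U s `\` \bigcup_(s' in [set s' : D | prefix (val s) (val s') /\ s != s']) U s'.

Definition trace (X : Type) (C : set (set X)) (Y : set X) : set (set X) :=
  [set Y `&` S | S in C].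

(* [is_family L n Y F]: F is a T-family in L^n(Y), where L j is the class
   Sigma^0_(1+j)(X), lightface or boldface. *)
Fixpoint is_family (X : Type) (k : option nat) (L : nat -> set (set X))
    (m : nat) : forall (T : itree k m) (n : nat) (Y : set X),
    family X T -> Prop :=
  match m with
  | 0 => fun _ _ _ _ => True
  | m'.+1 => fun T n Y F =>
      [/\ forall s, trace (L n) Y (F.1 s),
          forall s, val s = [::] -> F.1 s = Y,
          forall s s', prefix (val s) (val s') -> F.1 s' `<=` F.1 s &
          forall s, is_family L n.+1 (tilde F.1 s) (F.2 s)]
  end.

(* [determines Y F A]: the restriction of A to Y is the partition of Y
   determined by the T-family F. *)
Fixpoint determines (X : Type) (k : option nat) (m : nat) :
    forall (T : itree k m) (Y : set X), family X T -> (X -> kbar k) -> Prop :=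
  match m with
  | 0 => fun i Y _ A => forall x, Y x -> A x = i
  | m'.+1 => fun T Y F A => forall s, determines (tilde F.1 s) (F.2 s) A
  end.

Definition partition_class (X : Type) (k : option nat)
    (L : nat -> set (set X)) (T : tree_omega k) : set (X -> kbar k) :=
  [set A | exists2 F : family X (tagged T),
     is_family L 0 setT F & determines setT F A].

Definition eff_class (X : Type) (beta : nat -> set X) (k : option nat)
    (T : tree_omega k) : set (X -> kbar k) :=
  partition_class (eff_sigma0 beta) T.

Definition bold_class (X : topologicalType) (k : option nat)
    (T : tree_omega k) : set (X -> kbar k) :=
  partition_class (@bold_sigma0 X) T.

Definition strongly_uniformly_noncollapsing (X : topologicalType)
    (beta : nat -> set X) (k : option nat) : Prop :=
  forall T : tree_omega k,
    ~ (eff_class beta T `<=`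
       \bigcup_(V in [set V : tree_omega k | ~ tree_le T V])
          @bold_class X k V).

(* Main.v *)
Require Import Defs.
From mathcomp Require Import all_boot.
From mathcomp Require Import boolp classical_sets topology cantor.
From mathcomp Require Import finmap zify.

(* A point is read as a tape of bits which enumerates tokens and, on separate
   tracks, "moves".  One level up, a track carries the greatest token
   enumerated on it, if there is one; this is the jump, and the tokens and moves
   of level [l] are uniformly Sigma^0_(1+l).  The moves of level [l] lead to a
   node of an iterated tree, whose label is then read at level [l + 1]; this
   defines an effective partition in the class of [T].
   If that partition has a boldface [V]-family, a monotone map from [T] to [V]
   is built along the nodes of [T] by finite extension: the tapes which halt at
   a node and extend a long enough finite string all lie in one component of the
   family.  Friedberg jump inversion maps all tapes into this set, turning level
   1 into level 0 and the relevant Sigma^0_(2+n) sets into Sigma^0_(1+n) sets, so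
   that the labels compare by induction. *)

Set Implicit Arguments.
Unset Strict Implicit.
Unset Printing Implicit Defensive.

(** * Total recursive functions *)

(** No finite string forces a tape to halt at a node, since a walk can always go on. Conditions
    therefore carry, besides a finite string, a set of positions kept at 0, and two sets of tapes
    matter: the neighbourhood of the string, where the walk may still continue, and the tapes that
    obey the prohibition and stay at the node. Greatest tokens suit a construction in finite stages:
    one bit and a prohibition of larger tokens fix the greatest token of a track, while an unsettled
    track can be pushed beyond every bound. Tokens hand the content of a tape on to the next level:
    odd tracks pass tokens and even tracks pass moves, so that level 1 of one tape can copy all of
    level 0 of another. The inverting map decides countably many arbitrary open sets, which is how a
    lightface partition escapes boldface families. *)

Definition recf r (f : seq nat -> nat) : Prop :=
  partial_recursive (fun (v : r.-tuple nat) y => y = f v).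

Lemma partial_recursive_ext n (f g : n.-tuple nat -> nat -> Prop) :
  (forall v y, f v y <-> g v y) -> partial_recursive f -> partial_recursive g.
Proof.
move=> fg; suff -> : f = g by [].
by apply/funext => v; apply/funext => y; apply/propext.
Qed.

Lemma recf_ext r f g :
  (forall v, size v = r -> f v = g v) -> recf r f -> recf r g.
Proof.
move=> fg; apply: partial_recursive_ext => v y.
by rewrite fg // size_tuple.
Qed.

Lemma recf_proj r i : i < r -> recf r (fun v => nth 0 v i).
Proof.
move=> ir; apply: partial_recursive_ext (PR_proj (Ordinal ir)) => v y.
by rewrite (tnth_nth 0).
Qed.

Lemma recf_comp r f (gs : seq (seq nat -> nat)) :
  recf (size gs) f ->
  (forall i, i < size gs -> recf r (nth (fun=> 0) gs i)) ->
  recf r (fun v => f [seq g v | g <- gs]).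
Proof.
move=> rf rg.
apply: partial_recursive_ext (PR_comp rf (fun i => rg i (ltn_ord i))) => v y.
split=> [[w wE ->]|->].
  congr f; apply: (@eq_from_nth _ 0); first by rewrite size_tuple size_map.
  move=> i; rewrite size_tuple => iw.
  rewrite (nth_map (fun=> 0)) //.
  by rewrite -(wE (Ordinal iw)) (tnth_nth 0).
exists (map_tuple (fun g : seq nat -> nat => g v) (in_tuple gs)) => // i.
by rewrite (tnth_nth 0) /= (nth_map (fun=> 0)).
Qed.

Lemma recf_zero r : recf r (fun=> 0).
Proof. exact: PR_zero. Qed.

Lemma recf_succ r f : recf r f -> recf r (fun v => (f v).+1).
Proof.
move=> rf.
apply: (@recf_comp r (fun w => (nth 0 w 0).+1) [:: f]) => [|[]//].
apply: partial_recursive_ext PR_succ => v y.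
by case: (tupleP v) => a w; rewrite theadE.
Qed.

Lemma recf_const r c : recf r (fun=> c).
Proof. by elim: c => [|c IH]; [exact: recf_zero|exact: recf_succ]. Qed.

Fixpoint primrec (f g : seq nat -> nat) m v :=
  if m is m'.+1 then g [:: m', primrec f g m' v & v] else f v.

Lemma recf_primrec r f g n : recf r f -> recf r.+2 g -> recf r n ->
  recf r (fun v => primrec f g (n v) v).
Proof.
move=> rf rg rn.
have rp : recf r.+1 (fun v => primrec f g (head 0 v) (behead v)).
  apply: partial_recursive_ext (PR_prec rf rg) => v y.
  case: (tupleP v) => m w; rewrite theadE /=.
  have -> : [tuple of behead [tuple of m :: w]] = w by apply: val_inj.
  elim: m y => [|m IH] y //=; split=> [[z /IH -> ->] //|->].
  by exists (primrec f g m w); [apply/IH|].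
pose gs := n :: mkseq (fun i v => nth 0 v i) r.
have sgs : size gs = r.+1 by rewrite /= size_mkseq.
have := @recf_comp r _ gs; rewrite sgs => /(_ _ rp) H.
apply: recf_ext (H _) => [v vr|[|i] ir //=].
  rewrite /= -map_comp; congr (primrec _ _ _ _).
  by rewrite -[RHS](mkseq_nth 0) vr.
by rewrite nth_mkseq //; exact: recf_proj.
Qed.

Lemma recf_behead r f : recf r f -> recf r.+1 (fun v => f (behead v)).
Proof.
move=> rf; pose gs := mkseq (fun i v => nth 0 v i.+1) r.
have sgs : size gs = r by rewrite /= size_mkseq.
have := @recf_comp r.+1 f gs; rewrite sgs => /(_ rf) H.
apply: recf_ext (H _) => [[|a v] //= [vr]|i ir].
  by rewrite -map_comp -[v in RHS](mkseq_nth 0) vr.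
by rewrite nth_mkseq //; exact: recf_proj.
Qed.

Lemma recf_add r f g : recf r f -> recf r g -> recf r (fun v => f v + g v).
Proof.
move=> rf rg; have rs : recf r.+2 (fun w => (nth 0 w 1).+1).
  exact/recf_succ/recf_proj.
apply: recf_ext (recf_primrec rg rs rf) => v _.
by elim: (f v) => //= m ->; rewrite addSn.
Qed.

Lemma recf_mul r f g : recf r f -> recf r g -> recf r (fun v => f v * g v).
Proof.
move=> rf rg; have rs : recf r.+2 (fun w => g (behead (behead w)) + nth 0 w 1).
  by apply: recf_add; [exact: recf_behead (recf_behead rg)|exact: recf_proj].
apply: recf_ext (recf_primrec (recf_zero r) rs rf) => v _.
by elim: (f v) => //= m ->; rewrite mulSn.
Qed.

Lemma recf_pred r f : recf r f -> recf r (fun v => (f v).-1).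
Proof.
move=> rf; have rs : recf r.+2 (fun w => nth 0 w 0) by exact: recf_proj.
by apply: recf_ext (recf_primrec (recf_zero r) rs rf) => v _; case: (f v).
Qed.

Lemma recf_sub r f g : recf r f -> recf r g -> recf r (fun v => f v - g v).
Proof.
move=> rf rg; have rs : recf r.+2 (fun w => (nth 0 w 1).-1).
  exact/recf_pred/recf_proj.
apply: recf_ext (recf_primrec rf rs rg) => v _.
by elim: (g v) => [|m] /=; [rewrite subn0|move=> ->; rewrite subnS].
Qed.

Lemma recf_double r f : recf r f -> recf r (fun v => (f v).*2).
Proof.
by move=> rf; apply: recf_ext (recf_add rf rf) => v _; rewrite addnn.
Qed.

Lemma recf_exp2 r f : recf r f -> recf r (fun v => 2 ^ f v).
Proof.
move=> rf; have rs : recf r.+2 (fun w => (nth 0 w 1).*2).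
  exact/recf_double/recf_proj.
apply: recf_ext (recf_primrec (recf_const r 1) rs rf) => v _.
by elim: (f v) => //= m ->; rewrite expnS mul2n.
Qed.

Lemma recf_sum r f n : recf r.+1 f -> recf r n ->
  recf r (fun v => \sum_(i < n v) f ((i : nat) :: v)).
Proof.
move=> rf rn.
have rs : recf r.+2 (fun w => f (nth 0 w 0 :: behead (behead w)) + nth 0 w 1).
  apply: recf_add; last exact: recf_proj.
  pose gs := (fun w => nth 0 w 0) :: mkseq (fun i v => nth 0 v i.+2) r.
  have sgs : size gs = r.+1 by rewrite /= size_mkseq.
  have := @recf_comp r.+2 f gs; rewrite sgs => /(_ rf) H.
  apply: recf_ext (H _) => [[|a [|b v]] //= [vr]|[|i] ir].
  - by rewrite -map_comp -[v in RHS](mkseq_nth 0) vr.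
  - exact: recf_proj.
  - by rewrite /= nth_mkseq //; exact: recf_proj.
apply: recf_ext (recf_primrec (recf_zero r) rs rn) => v _.
elim: (n v) => [|m IH] /=; first by rewrite big_ord0.
by rewrite big_ord_recr /= IH addnC.
Qed.

Definition recb r (P : seq nat -> bool) : Prop := recf r (fun v => P v).

Lemma recb_ext r (P P' : seq nat -> bool) :
  (forall v, size v = r -> P v = P' v) -> recb r P -> recb r P'.
Proof. by move=> PP; apply: recf_ext => v /PP ->. Qed.

Lemma recb_leq r f g : recf r f -> recf r g -> recb r (fun v => f v <= g v).
Proof.
move=> rf rg.
apply: recf_ext (recf_sub (recf_const r 1) (recf_sub rf rg)) => v _.
lia.
Qed.

Lemma recb_neg r P : recb r P -> recb r (fun v => ~~ P v).
Proof.
move=> rP; apply: recf_ext (recf_sub (recf_const r 1) rP) => v _.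
by case: (P v).
Qed.

Lemma recb_and r P P' : recb r P -> recb r P' -> recb r (fun v => P v && P' v).
Proof.
by move=> rP rP'; apply: recf_ext (recf_mul rP rP') => v _; rewrite mulnb.
Qed.

Lemma recb_or r P P' : recb r P -> recb r P' -> recb r (fun v => P v || P' v).
Proof.
move=> rP rP'; apply: recb_ext (recb_neg (recb_and (recb_neg rP) (recb_neg rP'))).
by move=> v _; rewrite negb_and !negbK.
Qed.

Lemma recb_eq r f g : recf r f -> recf r g -> recb r (fun v => f v == g v).
Proof.
move=> rf rg; apply: recb_ext (recb_and (recb_leq rf rg) (recb_leq rg rf)).
by move=> v _; rewrite eqn_leq.
Qed.

Lemma recb_all r P n : recb r.+1 P -> recf r n ->
  recb r (fun v => [forall i : 'I_(n v), P ((i : nat) :: v)]).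
Proof.
move=> rP rn.
apply: recb_ext (recb_eq (recf_sum (recb_neg rP) rn) (recf_zero r)) => v _.
rewrite sum_nat_eq0; apply: eq_forallb => i /=.
by case: (P _).
Qed.

Lemma recb_odd r f : recf r f -> recb r (fun v => odd (f v)).
Proof.
move=> rf; have rs : recf r.+2 (fun w => 1 - nth 0 w 1).
  by apply: recf_sub; [exact: recf_const|exact: recf_proj].
apply: recf_ext (recf_primrec (recf_zero r) rs rf) => v _.
by elim: (f v) => //= m ->; case: (odd m).
Qed.

(** * Recursiveness of the decoding of strings *)

Definition code_head c := head 0 (CodeSeq.decode c).
Definition code_tail c := CodeSeq.code (behead (CodeSeq.decode c)).

Lemma codeP c : 0 < c -> c = 2 ^ code_head c * (code_tail c).*2.+1.
Proof.
rewrite /code_head /code_tail -{1 2}(CodeSeq.decodeK c).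
by case: (CodeSeq.decode c).
Qed.

Lemma code_head_mul a b : code_head (2 ^ a * b.*2.+1) = a.
Proof.
have -> : 2 ^ a * b.*2.+1 = CodeSeq.code (a :: CodeSeq.decode b).
  by rewrite /= -/(CodeSeq.code _) CodeSeq.decodeK.
by rewrite /code_head CodeSeq.codeK.
Qed.

Lemma code_tail_mul a b : code_tail (2 ^ a * b.*2.+1) = b.
Proof.
have -> : 2 ^ a * b.*2.+1 = CodeSeq.code (a :: CodeSeq.decode b).
  by rewrite /= -/(CodeSeq.code _) CodeSeq.decodeK.
by rewrite /code_tail CodeSeq.codeK /= CodeSeq.decodeK.
Qed.

Lemma sum_single n (F : nat -> nat) i0 :
  i0 < n -> (forall i, i != i0 -> F i = 0) -> \sum_(i < n) F i = F i0.
Proof.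
move=> lt0 F0; rewrite (bigD1 (Ordinal lt0)) //= big1 ?addn0 // => i ne.
by apply: F0; apply: contraNneq ne => e; apply/eqP/val_inj.
Qed.

Lemma code_sum (G : nat -> nat -> nat) c : 0 < c ->
  \sum_(n < c) \sum_(m < c) G n m * (c == 2 ^ n * m.*2.+1) =
  G (code_head c) (code_tail c).
Proof.
move=> c0; have cE := codeP c0.
have hc : code_head c < c.
  by rewrite {2}cE (leq_trans (ltn_expl _ (isT : 1 < 2))) // leq_pmulr.
have tc : code_tail c < c.
  have := leq_pmull (code_tail c).*2.+1 (expn_gt0 2 (code_head c)).
  by rewrite -cE; lia.
have ne n m : c == 2 ^ n * m.*2.+1 -> n = code_head c /\ m = code_tail c.
  by move=> /eqP ->; rewrite code_head_mul code_tail_mul.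
pose H n m := G n m * (c == 2 ^ n * m.*2.+1).
have H0 n m : (n != code_head c) || (m != code_tail c) -> H n m = 0.
  rewrite /H; case: (c =P _) => [/eqP/ne[-> ->]|]; rewrite ?muln0 // !eqxx //.
have -> : G (code_head c) (code_tail c) = H (code_head c) (code_tail c).
  by rewrite /H -cE eqxx muln1.
rewrite -(sum_single (F := H _) tc) => [|i ni]; last by rewrite H0 // ni orbT.
apply: (sum_single (F := fun n => \sum_(m < c) H n m) hc) => i ni.
by rewrite big1 // => m _; rewrite H0 // ni.
Qed.

(** Head and tail of a nonzero code lie below the code, so bounded search finds them. The pair is
    unique, hence the search can be written as a sum with a single nonzero term. At code 0 the sum
    is empty, which matches the default value 0 of the head. *)
Lemma recf_code_sum r (F : seq nat -> nat) g :
  recf r.+2 F -> recf r g ->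
  recf r (fun v => \sum_(n < g v) \sum_(m < g v)
    F [:: (m : nat), (n : nat) & v] * (g v == 2 ^ n * m.*2.+1)).
Proof.
move=> rF rg.
apply: recf_ext (recf_sum (f := fun w => \sum_(m < g (behead w))
  (F ((m : nat) :: w) * (g (behead w) == 2 ^ nth 0 w 0 * m.*2.+1))) _ rg) => //.
apply: recf_ext (recf_sum (f := fun w => F w *
  (g (behead (behead w)) == 2 ^ nth 0 w 1 * (nth 0 w 0).*2.+1)) _
  (recf_behead rg)) => //.
apply: recf_mul => //.
apply: (@recb_eq _ (fun w => g (behead (behead w)))
  (fun w => 2 ^ nth 0 w 1 * (nth 0 w 0).*2.+1)).
  exact: recf_behead (recf_behead rg).
apply: (@recf_mul _ (fun w => 2 ^ nth 0 w 1)); first exact/recf_exp2/recf_proj.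
exact/recf_succ/recf_double/recf_proj.
Qed.

Lemma recf_code_head r f : recf r f -> recf r (fun v => code_head (f v)).
Proof.
move=> rf.
apply: recf_ext (recf_code_sum (recf_proj (isT : 1 < r.+2)) rf) => v _ /=.
case: (posnP (f v)) => [->|]; first by rewrite big_ord0.
exact: (@code_sum (fun n m => n)).
Qed.

Lemma recf_code_tail r f : recf r f -> recf r (fun v => code_tail (f v)).
Proof.
move=> rf.
apply: recf_ext (recf_code_sum (recf_proj (isT : 0 < r.+2)) rf) => v _ /=.
case: (posnP (f v)) => [->|]; first by rewrite big_ord0.
exact: (@code_sum (fun n m => m)).
Qed.

Lemma iter_code_tail n c :
  iter n code_tail c = CodeSeq.code (drop n (CodeSeq.decode c)).
Proof.
elim: n => [|n IH]; first by rewrite drop0 CodeSeq.decodeK.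
rewrite iterS IH /code_tail CodeSeq.codeK; congr CodeSeq.code.
by rewrite -drop1 drop_drop.
Qed.

(** The two default values differ so that beyond the end of the string neither [bit_code] nor
    [cobit_code] holds. Both thus express known information, which persists when the string
    grows. *)
Definition bit_code c p := nth false (map odd (CodeSeq.decode c)) p.
Definition cobit_code c p := ~~ nth true (map odd (CodeSeq.decode c)) p.

Lemma recf_iter_tail r f g : recf r f -> recf r g ->
  recf r (fun v => iter (f v) code_tail (g v)).
Proof.
move=> rf rg.
have rs : recf r.+2 (fun w => code_tail (nth 0 w 1)).
  exact/recf_code_tail/recf_proj.
apply: recf_ext (recf_primrec rg rs rf) => v _.
by elim: (f v) => //= m ->.
Qed.

Lemma code_eq0 s : (CodeSeq.code s == 0) = (s == [::]).
Proof. by case: s => //= a s; rewrite muln_eq0 expn_eq0. Qed.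

Lemma bit_codeE c p (t := iter p code_tail c) :
  bit_code c p = odd (code_head t).
Proof.
rewrite /t iter_code_tail /code_head CodeSeq.codeK -nth0 nth_drop addn0.
rewrite /bit_code; case: (ltnP p (size (CodeSeq.decode c))) => pc.
  by rewrite (nth_map 0).
by rewrite !nth_default // size_map.
Qed.

(** The test [t != 0] says that [p] lies inside the string, as only the empty string has code 0. *)
Lemma cobit_codeE c p (t := iter p code_tail c) :
  cobit_code c p = (t != 0) && ~~ odd (code_head t).
Proof.
rewrite /t iter_code_tail code_eq0 /code_head CodeSeq.codeK -nth0 nth_drop addn0.
rewrite -size_eq0 size_drop subn_eq0 -ltnNge /cobit_code.
case: (ltnP p (size (CodeSeq.decode c))) => pc; first by rewrite (nth_map 0).
by rewrite !nth_default // size_map.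
Qed.

Lemma recb_bit r f g : recf r f -> recf r g ->
  recb r (fun v => bit_code (f v) (g v)).
Proof.
move=> rf rg.
have := recb_odd (recf_code_head (recf_iter_tail rg rf)).
by apply: recb_ext => v _; rewrite bit_codeE.
Qed.

Lemma recb_cobit r f g : recf r f -> recf r g ->
  recb r (fun v => cobit_code (f v) (g v)).
Proof.
move=> rf rg; have rt := recf_iter_tail rg rf.
have := recb_and (recb_neg (recb_eq rt (recf_zero r)))
  (recb_neg (recb_odd (recf_code_head rt))).
by apply: recb_ext => v _; rewrite cobit_codeE.
Qed.

(** * Pairing, and c.e. sets from recursive predicates *)

Definition pr a b := (2 ^ a * b.*2.+1).-1.
Definition pfst j := code_head j.+1.
Definition psnd j := code_tail j.+1.

Lemma prS a b : (pr a b).+1 = 2 ^ a * b.*2.+1.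
Proof. by rewrite prednK // muln_gt0 expn_gt0. Qed.

Lemma pfstK a b : pfst (pr a b) = a.
Proof. by rewrite /pfst prS code_head_mul. Qed.

Lemma psndK a b : psnd (pr a b) = b.
Proof. by rewrite /psnd prS code_tail_mul. Qed.

Lemma prK j : pr (pfst j) (psnd j) = j.
Proof. by apply/succn_inj; rewrite prS -codeP. Qed.

Lemma leq_pr1 a b : a <= pr a b.
Proof.
rewrite -ltnS prS (leq_trans (ltn_expl _ (isT : 1 < 2))) //.
exact: leq_pmulr.
Qed.

Lemma leq_pr2 a b : b <= pr a b.
Proof.
rewrite -ltnS prS; have := leq_pmull b.*2.+1 (expn_gt0 2 a).
lia.
Qed.

Lemma ltn_pr a b b' : b < b' -> pr a b < pr a b'.
Proof.
move=> lt; rewrite -ltnS !prS ltn_pmul2l ?expn_gt0 //.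
by rewrite ltnS ltn_double.
Qed.

Lemma recf_pr r f g : recf r f -> recf r g -> recf r (fun v => pr (f v) (g v)).
Proof.
move=> rf rg; apply: recf_pred; apply: recf_mul; first exact: recf_exp2.
exact/recf_succ/recf_double.
Qed.

Lemma recf_pfst r f : recf r f -> recf r (fun v => pfst (f v)).
Proof. by move=> rf; apply/recf_code_head/recf_succ. Qed.

Lemma recf_psnd r f : recf r f -> recf r (fun v => psnd (f v)).
Proof. by move=> rf; apply/recf_code_tail/recf_succ. Qed.

Lemma ce_ex r P : recb r.+1 P ->
  ce (fun v : r.-tuple nat => exists y, P (y :: v)).
Proof.
move=> rP; exists (fun v y => ~~ P (y :: v) = 0 :> nat /\
  forall z, z < y -> exists u, u.+1 = ~~ P (z :: v) :> nat).
  have := PR_mu (recb_neg rP).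
  apply: partial_recursive_ext => v y /=; split=> -[e H]; split; by [|exact: H].
move=> v; split=> [/ex_minnP[y Py miny]|[y [Py _]]].
  exists y; split; first by rewrite Py.
  move=> z zy; exists 0; case Pz: (P _) => //.
  by move/miny: Pz; rewrite leqNgt zy.
by exists y; move: Py; case: (P _).
Qed.

(** * Uniformly Sigma^0_(1+n) families *)

(** The [d] leading arguments are replaced by the values of [hs] and the last [r] are kept: union
    indices are consed in front, so this one form covers both weakening and reindexing. *)
Lemma recf_subst d r f (hs : seq (seq nat -> nat)) :
  recf (size hs + r) f ->
  (forall i, i < size hs -> recf (d + r) (nth (fun=> 0) hs i)) ->
  recf (d + r) (fun w => f ([seq h w | h <- hs] ++ drop d w)).
Proof.
move=> rf rh; pose gs := hs ++ mkseq (fun i w => nth 0 w (d + i)) r.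
have sgs : size gs = size hs + r by rewrite size_cat size_mkseq.
have := @recf_comp (d + r) f gs; rewrite sgs => /(_ rf) H.
apply: recf_ext (H _) => [w wr|i ir].
  rewrite map_cat; congr (f (_ ++ _)).
  apply: (@eq_from_nth _ 0); first by rewrite !size_map size_iota size_drop wr addKn.
  move=> i; rewrite size_map size_mkseq => ir.
  by rewrite (nth_map (fun=> 0)) ?size_mkseq // nth_mkseq // nth_drop.
rewrite nth_cat; case: ltnP => [/rh //|hi].
have ir' : i - size hs < r by rewrite ltn_subLR.
by rewrite nth_mkseq //; apply: recf_proj; rewrite ltn_add2l.
Qed.

Section UniformSets.
Local Open Scope classical_set_scope.
Variables (X : Type) (b : X -> nat -> bool) (beta : nat -> set X).
Hypothesis beta_bits : forall c x, beta c x ->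
  map odd (CodeSeq.decode c) = mkseq (b x) (size (CodeSeq.decode c)).
Hypothesis beta_fine : forall x n,
  exists2 c, beta c x & n <= size (CodeSeq.decode c).

Definition ce_union (P : seq nat -> bool) v : set X :=
  [set x | exists2 c, beta c x & exists y, P [:: y, c & v]].

(* Upward closure along [beta] turns intersections of open sets into
   conjunctions of their enumerations. *)
Definition stable_pred r (P : seq nat -> bool) : Prop :=
  forall v c c' y, size v = r ->
    prefix (map odd (CodeSeq.decode c)) (map odd (CodeSeq.decode c')) ->
    P [:: y, c & v] -> exists y', P [:: y', c' & v].

(** A stricter form of [unif_sigma0], with plain lists as parameters and a stable recursive matrix
    at the bottom level; in this form the closure properties are direct. *)
Fixpoint usigma n r (A : seq nat -> set X) : Prop :=
  match n with
  | 0 => exists P, [/\ recb r.+2 P, stable_pred r P &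
           forall v, size v = r -> A v = ce_union P v]
  | n'.+1 => exists F G, [/\ usigma n' r.+1 F, usigma n' r.+1 G &
           forall v, size v = r -> A v = \bigcup_j (F (j :: v) `\` G (j :: v))]
  end.

Lemma usigma_unif n r A : usigma n r A ->
  unif_sigma0 beta n (fun v : r.-tuple nat => A v).
Proof.
elim: n r A => [|n IH] r A /=.
  case=> P [rP _ AE]; exists (fun v => exists y, P (y :: v)).
    exact: ce_ex.
  move=> v; rewrite AE ?size_tuple //.
  by apply/seteqP; split=> x [c]; exists c.
case=> F [G [/IH gF /IH gG AE]].
exists (fun v => F v), (fun v => G v); split=> // v.
by rewrite AE // size_tuple.
Qed.

Lemma usigma_ext n r A B : (forall v, size v = r -> A v = B v) ->
  usigma n r A -> usigma n r B.
Proof.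
case: n => [|n] AB /=.
  by case=> P [rP sP PE]; exists P; split=> // v vr; rewrite -AB // PE.
by case=> F [G [gF gG E]]; exists F, G; split=> // v vr; rewrite -AB // E.
Qed.

Lemma usigma_subst n d r A (hs : seq (seq nat -> nat)) :
  usigma n (size hs + r) A ->
  (forall i, i < size hs -> recf (d + r) (nth (fun=> 0) hs i)) ->
  usigma n (d + r) (fun w => A ([seq h w | h <- hs] ++ drop d w)).
Proof.
elim: n d r A hs => [|n IH] d r A hs /=.
  case=> P [rP sP AE] rh.
  pose hs' := [:: (fun w => nth 0 w 0), (fun w => nth 0 w 1) &
    [seq (fun w => h (behead (behead w))) | h <- hs]].
  have hsE y c v : [seq h [:: y, c & v] | h <- hs'] =
      [:: y, c & [seq h v | h <- hs]] by rewrite /= -map_comp.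
  exists (fun w => P ([seq h w | h <- hs'] ++ drop d.+2 w)); split.
  - apply: (@recf_subst d.+2 r P hs'); first by rewrite /= size_map.
    case=> [|[|i]] /=; try by move=> _; exact: recf_proj.
    rewrite size_map !ltnS => ih; rewrite (nth_map (fun=> 0)) //.
    exact: recf_behead (recf_behead (rh i ih)).
  - move=> v c c' y vr cc'; rewrite hsE => Py.
    have [|y' Py'] := sP ([seq h v | h <- hs] ++ drop d v) c c' y _ cc' Py.
      by rewrite size_cat size_map size_drop vr addKn.
    by exists y'; rewrite hsE.
  - move=> v vr; rewrite AE; last by rewrite size_cat size_map size_drop vr addKn.
    apply/seteqP; split=> x [c xc [y Py]]; exists c => //; exists y.
      by rewrite hsE.
    by move: Py; rewrite hsE.
case=> F [G [gF gG AE]] rh.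
pose hs' := (fun w => nth 0 w 0) :: [seq (fun w => h (behead w)) | h <- hs].
have shs' : size hs' = (size hs).+1 by rewrite /= size_map.
have rh' i : i < size hs' -> recf (d.+1 + r) (nth (fun=> 0) hs' i).
  case: i => [|i] /=; first by move=> _; exact: recf_proj.
  rewrite size_map ltnS => ih; rewrite (nth_map (fun=> 0)) //.
  exact/recf_behead/rh.
exists (fun w => F ([seq h w | h <- hs'] ++ drop d.+1 w)).
exists (fun w => G ([seq h w | h <- hs'] ++ drop d.+1 w)); split.
- by apply: (IH d.+1 r) => //; rewrite shs'.
- by apply: (IH d.+1 r) => //; rewrite shs'.
move=> v vr; rewrite AE; last by rewrite size_cat size_map size_drop vr addKn.
by congr (bigcup _ _); apply/funext => j; rewrite /= -map_comp.
Qed.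

Lemma usigma_weaken n r A : usigma n r A -> usigma n r.+1 (fun w => A (behead w)).
Proof.
move=> gA; have := @usigma_subst n 1 r A [::] gA.
by move=> H; apply: usigma_ext (H _) => // -[|? w] //; rewrite drop1.
Qed.

Lemma usigma_head n r A h : usigma n r.+1 A -> recf r.+1 h ->
  usigma n r.+1 (fun w => A (h w :: behead w)).
Proof.
move=> gA rh; have := @usigma_subst n 1 r A [:: h] gA.
move=> H; apply: usigma_ext (H _); last by case.
by move=> w _; rewrite /= drop1.
Qed.

Lemma usigma_head2 n r A h h' : usigma n r.+2 A -> recf r.+1 h -> recf r.+1 h' ->
  usigma n r.+1 (fun w => A [:: h w, h' w & behead w]).
Proof.
move=> gA rh rh'; have := @usigma_subst n 1 r A [:: h; h'] gA.
move=> H; apply: usigma_ext (H _); last by case=> [|[]].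
by move=> w _; rewrite /= drop1.
Qed.

(** With a test on the union index this turns a binary union into a countable one. *)
Lemma usigma_if n r A B p : recb r p -> usigma n r A -> usigma n r B ->
  usigma n r (fun v => if p v then A v else B v).
Proof.
elim: n r A B p => [|n IH] r A B p rp /=.
  case=> P [rP sP AE] [P' [rP' sP' BE]].
  have rp2 : recb r.+2 (fun w => p (behead (behead w))).
    exact: recf_behead (recf_behead rp).
  exists (fun w => if p (behead (behead w)) then P w else P' w); split.
  - apply: recb_ext (recb_or (recb_and rp2 rP) (recb_and (recb_neg rp2) rP')).
    by move=> w _; case: (p _) => /=; rewrite ?orbF.
  - by move=> v c c' y vr cc' /=; case: (p v); [exact: sP|exact: sP'].
  - by move=> v vr; rewrite /ce_union /=; case: (p v); rewrite ?AE ?BE.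
case=> F [G [gF gG AE]] [F' [G' [gF' gG' BE]]].
exists (fun w => if p (behead w) then F w else F' w).
exists (fun w => if p (behead w) then G w else G' w).
have rp1 := recf_behead rp.
by split; [exact: IH|exact: IH|move=> v vr /=; case: (p v); rewrite ?AE ?BE].
Qed.

Lemma usigma_bigcup n r A : usigma n r.+1 A ->
  usigma n r (fun v => \bigcup_j A (j :: v)).
Proof.
case: n => [|n] /=.
  case=> P [rP sP AE].
  exists (fun w => P [:: pfst (nth 0 w 0), nth 0 w 1, psnd (nth 0 w 0) & behead (behead w)]).
  split.
  - have := @recf_subst 2 r P [:: (fun w => pfst (nth 0 w 0)); (fun w => nth 0 w 1);
      (fun w => psnd (nth 0 w 0))] rP.
    move=> H; apply: recf_ext (H _) => [[|? []] //= *|]; first by rewrite drop0.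
    case=> [|[|[|]]] //= _; last exact/recf_psnd/recf_proj.
      exact/recf_pfst/recf_proj.
    exact: recf_proj.
  - move=> v c c' y vr cc' /= Py.
    have [|y' Py'] := sP (psnd y :: v) c c' _ _ cc' Py.
      by rewrite /= vr.
    by exists (pr y' (psnd y)); rewrite pfstK psndK.
  - move=> v vr; apply/seteqP; split=> x.
      case=> j _; rewrite AE /= ?vr // => -[c xc [y Py]].
      by exists c => //; exists (pr y j); rewrite pfstK psndK.
    case=> c xc [y /= Py]; exists (psnd y) => //; rewrite AE /= ?vr //.
    by exists c => //; exists (pfst y).
case=> F [G [gF gG AE]].
pose h0 (w : seq nat) := pfst (nth 0 w 0).
pose h1 (w : seq nat) := psnd (nth 0 w 0).
have r0 : recf r.+1 h0 by exact/recf_pfst/recf_proj.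
have r1 : recf r.+1 h1 by exact/recf_psnd/recf_proj.
exists (fun w => F [:: h0 w, h1 w & behead w]).
exists (fun w => G [:: h0 w, h1 w & behead w]); split; try exact: usigma_head2.
move=> v vr; apply/seteqP; split=> x.
  case=> j _; rewrite AE /= ?vr // => -[i _ FG].
  by exists (pr i j) => //; rewrite /h0 /h1 /= pfstK psndK.
by case=> k _ FG; exists (h1 (k :: v)) => //; rewrite AE /= ?vr //; exists (h0 (k :: v)).
Qed.

Lemma usigma_setU n r A B : usigma n r A -> usigma n r B ->
  usigma n r (fun v => A v `|` B v).
Proof.
move=> gA gB; have rp : recb r.+1 (fun w => nth 0 w 0 == 0).
  by apply: recb_eq; [exact: recf_proj|exact: recf_zero].
apply: usigma_ext (usigma_bigcup (usigma_if rp (usigma_weaken gA) (usigma_weaken gB))).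
move=> v _; apply/seteqP; split=> x /=; first by case=> -[|j] _ /=; [left|right].
by case=> ?; [exists 0|exists 1].
Qed.

Lemma usigma_setI n r A B : usigma n r A -> usigma n r B ->
  usigma n r (fun v => A v `&` B v).
Proof.
elim: n r A B => [|n IH] r A B /=.
  case=> P [rP sP AE] [P' [rP' sP' BE]].
  have rh (f : nat -> nat) (Q : seq nat -> bool) : recf r.+2 (fun w => f (nth 0 w 0)) ->
      recb r.+2 Q -> recb r.+2 (fun w => Q (f (nth 0 w 0) :: behead w)).
    move=> rf rQ; have := @recf_subst 1 r.+1 Q [:: fun w => f (nth 0 w 0)] rQ.
    move=> H; apply: recf_ext (H _); last by case.
    by move=> w _; rewrite /= drop1.
  exists (fun w => P (pfst (nth 0 w 0) :: behead w) && P' (psnd (nth 0 w 0) :: behead w)).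
  split.
  - apply: recb_and; apply: rh => //; first exact/recf_pfst/recf_proj.
    exact/recf_psnd/recf_proj.
  - move=> v c c' y vr cc' /= /andP[Py P'y].
    have [y1 Py1] := sP v c c' _ vr cc' Py.
    have [y2 Py2] := sP' v c c' _ vr cc' P'y.
    by exists (pr y1 y2); rewrite pfstK psndK /= Py1.
  - move=> v vr; rewrite AE // BE //; apply/seteqP; split=> x; last first.
      case=> c xc [y /= /andP[Py P'y]]; split; exists c => //.
        by exists (pfst y).
      by exists (psnd y).
    (* Two codes of neighbourhoods of one point read initial segments of the same bit sequence. The
       witness for the shorter one can therefore be moved to the longer one by stability. *)
    have bpre c c' : beta c x -> beta c' x ->
        size (CodeSeq.decode c) <= size (CodeSeq.decode c') ->
        prefix (map odd (CodeSeq.decode c)) (map odd (CodeSeq.decode c')).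
      move=> /beta_bits -> /beta_bits -> cc'.
      by rewrite prefixE size_mkseq -map_take take_iota (minn_idPl cc').
    case=> -[c xc [y Py]] [c' xc' [y' Py']].
    case/orP: (leq_total (size (CodeSeq.decode c)) (size (CodeSeq.decode c'))) => le.
      have [z Pz] := sP v c c' y vr (bpre _ _ xc xc' le) Py.
      by exists c' => //; exists (pr z y'); rewrite /= pfstK psndK Pz.
    have [z Pz] := sP' v c' c y' vr (bpre _ _ xc' xc le) Py'.
    by exists c => //; exists (pr y z); rewrite /= pfstK psndK Py.
case=> F [G [gF gG AE]] [F' [G' [gF' gG' BE]]].
pose h0 (w : seq nat) := pfst (nth 0 w 0).
pose h1 (w : seq nat) := psnd (nth 0 w 0).
have r0 : recf r.+1 h0 by exact/recf_pfst/recf_proj.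
have r1 : recf r.+1 h1 by exact/recf_psnd/recf_proj.
exists (fun w => F (h0 w :: behead w) `&` F' (h1 w :: behead w)).
exists (fun w => G (h0 w :: behead w) `|` G' (h1 w :: behead w)); split.
- by apply: IH; exact: usigma_head.
- by apply: usigma_setU; exact: usigma_head.
move=> v vr; rewrite AE // BE //; apply/seteqP; split=> x.
  case=> -[j _ [Fj Gj]] [j' _ [Fj' Gj']]; exists (pr j j') => //=.
  by rewrite /h0 /h1 /= pfstK psndK; split=> // -[].
case=> k _ [[Fk Fk'] nG]; split.
  by exists (h0 (k :: v)) => //; split=> // ?; apply: nG; left.
by exists (h1 (k :: v)) => //; split=> // ?; apply: nG; right.
Qed.

Lemma usigma_cst n r : usigma n r (fun=> set0) /\ usigma n r (fun=> setT).
Proof.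
elim: n r => [|n IH] r /=.
  split.
    exists (fun=> false); split; [exact: (recf_const _ 0)|by []|move=> v _].
    by apply/seteqP; split=> // x [c _ []].
  exists (fun=> true); split; [exact: (recf_const _ 1)|by exists 0|move=> v _].
  apply/seteqP; split=> // x _; have [c xc _] := beta_fine x 0.
  by exists c => //; exists 0.
have [g0 gT] := IH r.+1.
split; [exists (fun=> set0), (fun=> set0)|exists (fun=> setT), (fun=> set0)].
  by split=> // v _; apply/seteqP; split=> [x|x [j _ [[]]]].
by split=> // v _; apply/seteqP; split=> // x _; exists 0 => //; split=> // -[].
Qed.

End UniformSets.

(** * Tapes and the partition of an iterated tree *)

Local Open Scope classical_set_scope.

Definition tape := nat -> bool.
(** Even positions hold tokens and odd ones hold moves. The argument [s] is a repetition counter: a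
    token can be enumerated beyond any given length. *)
Definition tp c s := (pr c s).*2.
Definition wp r t := (pr r t).*2.+1.

(** With larger values written as [(n + j).+1], the set to be subtracted is a plain countable union,
    as the difference hierarchy of levels requires. *)
Definition greatest (P : nat -> Prop) n := P n /\ ~ exists j, P (n + j).+1.

Fixpoint emits l c (x : tape) : Prop :=
  match l with
  | 0 => exists s, x (tp c s)
  | l'.+1 => exists r, greatest (fun n => emits l' (pr r.*2.+1 n) x) c
  end.

(** At level 0 the first 1 of row [r] decides, which is an open condition; a greatest value would
    cost one more level. The component [n] of [pr i n] is padding: a large [n] gives any move [i] a
    late position or a large token. *)
Definition moves l r i (x : tape) : Prop :=
  match l with
  | 0 => exists n, x (wp r (pr i n)) /\ forall t, t < pr i n -> ~~ x (wp r t)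
  | l'.+1 => exists n, greatest (fun n => emits l' (pr r.*2 n) x) (pr i n)
  end.

Definition follows l s x : Prop :=
  forall r, r < size s -> moves l r (nth 0 s r) x.

Lemma greatest_uniq P n n' : greatest P n -> greatest P n' -> n = n'.
Proof.
move=> [Pn mn] [Pn' mn']; case: (ltngtP n n') => // lt; exfalso.
  by apply: mn; exists (n' - n.+1); rewrite -addSn subnKC.
by apply: mn'; exists (n - n'.+1); rewrite -addSn subnKC.
Qed.

Lemma eq_greatest P P' n : (forall j, P j <-> P' j) -> greatest P n -> greatest P' n.
Proof. by move=> PP [/PP ? nP]; split=> // -[j /PP ?]; apply: nP; exists j. Qed.

Lemma moves_uniq l r i i' x : moves l r i x -> moves l r i' x -> i = i'.
Proof.
case: l => [|l] /= [n Hn] [n' Hn']; last first.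
  by have /(congr1 pfst) := greatest_uniq Hn Hn'; rewrite !pfstK.
case: Hn Hn' => [xn mn] [xn' mn'].
have : pr i n = pr i' n'.
  case: (ltngtP (pr i n) (pr i' n')) => // lt.
    by move: (mn' _ lt); rewrite xn.
  by move: (mn _ lt); rewrite xn'.
by move/(congr1 pfst); rewrite !pfstK.
Qed.

Lemma follows_prefix l s s' x : prefix s s' -> follows l s' x -> follows l s x.
Proof.
move=> /prefixP[u ->] H r rs; have := H r; rewrite size_cat nth_cat rs.
by apply; rewrite ltn_addr.
Qed.

Lemma follows_rcons l s i x :
  follows l (rcons s i) x <-> follows l s x /\ moves l (size s) i x.
Proof.
split=> [H|[H Hi] r].
  split; first exact: follows_prefix (prefix_rcons _ _) H.
  by have := H (size s); rewrite size_rcons nth_rcons ltnn eqxx; apply.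
rewrite size_rcons nth_rcons ltnS leq_eqVlt => /predU1P[->|rs].
  by rewrite ltnn eqxx.
by rewrite rs; exact: H.
Qed.

Lemma follows_total l s s' x : follows l s x -> follows l s' x ->
  size s <= size s' -> prefix s s'.
Proof.
move=> H H' ss'; rewrite prefixE; apply/eqP/(@eq_from_nth _ 0).
  by rewrite size_take_min (minn_idPl ss').
move=> r; rewrite size_take_min (minn_idPl ss') => rs.
rewrite nth_take //; apply: moves_uniq (H' r _) (H r rs).
exact: leq_trans rs ss'.
Qed.

Lemma prefix_antisym (s s' : seq nat) : prefix s s' -> prefix s' s -> s = s'.
Proof.
move=> ss' s's; move: (ss'); rewrite prefixE take_oversize ?size_prefix //.
by move/eqP.
Qed.

Lemma tree_root_in (Q : Type) (T : qtree Q) : [::] \in dom T.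
Proof.
have /fset0Pn[s sT] := dom_neq0 T.
exact: dom_prefix (prefix0s s) sT.
Qed.

Definition tree_root (Q : Type) (T : qtree Q) : dom T := [` tree_root_in T]%fset.

(** Moves are unique at each depth, so the strings that a tape follows form a chain, and the longest
    one in the finite tree extends all the others. The root is always followed. *)
Definition node (Q : Type) (T : qtree Q) l x : dom T :=
  [arg max_(s > tree_root T | `[< follows l (val s) x >]) size (val s)].

Lemma node_follows (Q : Type) (T : qtree Q) l x :
  follows l (val (node T l x)) x.
Proof. by rewrite /node; case: arg_maxnP => [|s /asboolP //]; apply/asboolP. Qed.

Lemma node_max (Q : Type) (T : qtree Q) l x (s : dom T) :
  follows l (val s) x -> prefix (val s) (val (node T l x)).
Proof.
move=> Hs. apply: (follows_total Hs (@node_follows _ T l x)).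
rewrite /node; case: arg_maxnP => [|s' _]; first exact/asboolP.
by apply; apply/asboolP.
Qed.

Lemma node_eq (Q : Type) (T : qtree Q) l x (s : dom T) :
  follows l (val s) x ->
  (forall s' : dom T, prefix (val s) (val s') -> s != s' ->
     ~ follows l (val s') x) -> node T l x = s.
Proof.
move=> Hs mx; apply/eqP; rewrite eq_sym; apply/negPn/negP => ne.
exact: (mx _ (node_max Hs) ne (@node_follows _ T l x)).
Qed.

Fixpoint col k m : itree k m -> nat -> tape -> kbar k :=
  match m with
  | 0 => fun i _ _ => i
  | m'.+1 => fun T l x => col (label (node T l x)) l.+1 x
  end.

(** * A lightface family which determines the partition *)

Section EffectiveFamilies.
Variables (X : Type) (b : X -> tape) (beta : nat -> set X).
Hypothesis beta_bits : forall c x, beta c x ->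
  map odd (CodeSeq.decode c) = mkseq (b x) (size (CodeSeq.decode c)).
Hypothesis beta_fine : forall x n,
  exists2 c, beta c x & n <= size (CodeSeq.decode c).

Lemma bit_beta c x p : beta c x -> bit_code c p -> b x p.
Proof.
move=> /beta_bits; rewrite /bit_code => ->.
case: (ltnP p (size (CodeSeq.decode c))) => pc; first by rewrite nth_mkseq.
by rewrite nth_default // size_mkseq.
Qed.

Lemma cobit_beta c x p : beta c x -> cobit_code c p -> ~~ b x p.
Proof.
move=> /beta_bits; rewrite /cobit_code => ->.
case: (ltnP p (size (CodeSeq.decode c))) => pc; first by rewrite nth_mkseq.
by rewrite nth_default // size_mkseq.
Qed.

Lemma beta_fine_bits x n : exists2 c, beta c x &
  forall p, p < n -> bit_code c p = b x p /\ cobit_code c p = ~~ b x p.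
Proof.
have [c xc nc] := beta_fine x n; exists c => // p pn.
rewrite /bit_code /cobit_code (beta_bits xc) !nth_mkseq //;
  exact: leq_trans nc.
Qed.

Lemma bit_code_prefix c c' p :
  prefix (map odd (CodeSeq.decode c)) (map odd (CodeSeq.decode c')) ->
  bit_code c p -> bit_code c' p.
Proof.
rewrite /bit_code => /prefixP[u ->]; rewrite nth_cat; case: ltnP => // pc.
by rewrite nth_default.
Qed.

Lemma cobit_code_prefix c c' p :
  prefix (map odd (CodeSeq.decode c)) (map odd (CodeSeq.decode c')) ->
  cobit_code c p -> cobit_code c' p.
Proof.
rewrite /cobit_code => /prefixP[u ->]; rewrite nth_cat; case: ltnP => // pc.
by rewrite nth_default.
Qed.

Notation usigma := (usigma beta).

Lemma usigma_comp n m A h : usigma n 1 A -> recf m h ->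
  usigma n m (fun v => A [:: h v]).
Proof.
move=> gA rh; have := @usigma_subst X beta n m 0 A [:: h] gA.
rewrite addn0 => H; apply: usigma_ext (H _); last by case.
by move=> v vm; rewrite /= drop_oversize // vm.
Qed.

Lemma recf_wp m f g : recf m f -> recf m g -> recf m (fun v => wp (f v) (g v)).
Proof. by move=> rf rg; apply/recf_succ/recf_double/recf_pr. Qed.

Lemma recf_tp m f g : recf m f -> recf m g -> recf m (fun v => tp (f v) (g v)).
Proof. by move=> rf rg; apply/recf_double/recf_pr. Qed.

Lemma usigma_emits l : usigma l 1 (fun v => [set x | emits l (nth 0 v 0) (b x)]).
Proof.
elim: l => [|l IH] /=.
  exists (fun w => bit_code (nth 0 w 1) (tp (nth 0 w 2) (nth 0 w 0))); split.
  - by apply: recb_bit; [exact: recf_proj|apply: recf_tp; exact: recf_proj].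
  - by move=> v c c' y _ cc' /= H; exists y; exact: bit_code_prefix H.
  - move=> v _; apply/seteqP; split=> x /=; last first.
      by case=> c xc [y /= /(bit_beta xc) Hy]; exists y.
    case=> s xs; have [c xc /(_ _ (ltnSn (tp (nth 0 v 0) s)))[H _]] :=
      beta_fine_bits x (tp (nth 0 v 0) s).+1.
    by exists c => //; exists s; rewrite /= H.
exists (fun w => [set x | emits l (pr (nth 0 w 0).*2.+1 (nth 0 w 1)) (b x)]).
exists (fun w => \bigcup_j
  [set x | emits l (pr (nth 0 w 0).*2.+1 (nth 0 w 1 + j).+1) (b x)]); split.
- apply: (usigma_comp (A := fun v => [set x | emits l (nth 0 v 0) (b x)])) => //.
  apply: recf_pr; last exact: recf_proj.
  exact/recf_succ/recf_double/recf_proj.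
- apply: (@usigma_bigcup X beta l 2 (fun w =>
    [set x | emits l (pr (nth 0 w 1).*2.+1 (nth 0 w 2 + nth 0 w 0).+1) (b x)])).
  apply: (usigma_comp (A := fun v => [set x | emits l (nth 0 v 0) (b x)])) => //.
  apply: recf_pr; first exact/recf_succ/recf_double/recf_proj.
  by apply/recf_succ/recf_add; exact: recf_proj.
- move=> v _; apply/seteqP; split=> x /=.
    case=> r [H nH]; exists r => //; split=> // -[j _ /= Hj].
    by apply: nH; exists j.
  case=> r _ [H nH]; exists r; split=> // -[j Hj].
  by apply: nH; exists j.
Qed.

Lemma usigma_moves l r i : usigma l 0 (fun=> [set x | moves l r i (b x)]).
Proof.
case: l => [|l] /=.
  exists (fun w => bit_code (nth 0 w 1) (wp r (pr i (nth 0 w 0))) &&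
    [forall t : 'I_(pr i (nth 0 w 0)), cobit_code (nth 0 w 1) (wp r t)]); split.
  - apply: recb_and.
      apply: recb_bit; first exact: recf_proj.
      apply: recf_wp; first exact: recf_const.
      by apply: recf_pr; [exact: recf_const|exact: recf_proj].
    apply: (@recb_all 2 (fun w => cobit_code (nth 0 w 2) (wp r (nth 0 w 0)))
      (fun w => pr i (nth 0 w 0))).
      apply: recb_cobit; first exact: recf_proj.
      by apply: recf_wp; [exact: recf_const|exact: recf_proj].
    by apply: recf_pr; [exact: recf_const|exact: recf_proj].
  - move=> v c c' y _ cc' /= /andP[H /forallP H']; exists y.
    rewrite (bit_code_prefix cc' H); apply/forallP => t.
    exact: cobit_code_prefix (H' t).
  - move=> v _; apply/seteqP; split=> x /=; last first.
      case=> c xc [n /= /andP[/(bit_beta xc) H /forallP H']].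
      by exists n; split=> // t tn; exact: cobit_beta xc (H' (Ordinal tn)).
    case=> n [xn mn]; have [c xc H] := beta_fine_bits x (wp r (pr i n)).+1.
    exists c => //; exists n; rewrite /= (H _ _).1 // xn.
    apply/forallP => t; rewrite (H _ _).2 ?mn // ltnS ltnW //.
    by rewrite /wp ltnS ltn_double ltn_pr.
exists (fun w => [set x | emits l (pr r.*2 (pr i (nth 0 w 0))) (b x)]).
exists (fun w => \bigcup_j
  [set x | emits l (pr r.*2 (pr i (nth 0 w 0) + j).+1) (b x)]); split.
- apply: (usigma_comp (A := fun v => [set x | emits l (nth 0 v 0) (b x)])).
    exact: usigma_emits.
  apply: recf_pr; first exact: recf_const.
  by apply: recf_pr; [exact: recf_const|exact: recf_proj].
- apply: (@usigma_bigcup X beta l 1 (fun w =>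
    [set x | emits l (pr r.*2 (pr i (nth 0 w 1) + nth 0 w 0).+1) (b x)])).
  apply: (usigma_comp (A := fun v => [set x | emits l (nth 0 v 0) (b x)])).
    exact: usigma_emits.
  apply: recf_pr; first exact: recf_const.
  apply/recf_succ/recf_add; last exact: recf_proj.
  by apply: recf_pr; [exact: recf_const|exact: recf_proj].
- move=> v _; apply/seteqP; split=> x /=.
    case=> n [H nH]; exists n => //; split=> // -[j _ /= Hj].
    by apply: nH; exists j.
  case=> n _ [H nH]; exists n; split=> // -[j Hj].
  by apply: nH; exists j.
Qed.

Lemma usigma_follows l s : usigma l 0 (fun=> [set x | follows l s (b x)]).
Proof.
elim/last_ind: s => [|s i IH].
  apply: usigma_ext (usigma_cst beta_fine l 0).2 => v _.
  by apply/seteqP; split.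
have := usigma_setI beta_bits IH (usigma_moves l (size s) i).
by apply: usigma_ext => v _; apply/seteqP; split=> x /=; rewrite follows_rcons.
Qed.

Definition follow_set (Q : Type) (T : qtree Q) l (Y : set X) (s : dom T) : set X :=
  Y `&` [set x | follows l (val s) (b x)].

Lemma tilde_follow_set (Q : Type) (T : qtree Q) l Y (s : dom T) x :
  tilde (follow_set (T := T) l Y) s x <-> Y x /\ node T l (b x) = s.
Proof.
split=> [[[Yx Hs] nH]|[Yx <-]].
  split=> //; apply: node_eq => // s' ss' ne Hs'.
  by apply: nH; exists s'.
split; first by split=> //; exact: node_follows.
case=> s' [/= pre /eqP ne] [_ /node_max pre']; apply/ne/val_inj.
exact: prefix_antisym.
Qed.

Fixpoint col_family k m : forall (T : itree k m) (l : nat) (Y : set X), Defs.family X T :=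
  match m with
  | 0 => fun _ _ _ => tt
  | m'.+1 => fun T l Y => (follow_set (T := T) l Y, fun s =>
      col_family (label s) l.+1 (tilde (follow_set (T := T) l Y) s))
  end.

Lemma is_family_col k m (T : itree k m) l Y :
  is_family (eff_sigma0 beta) l Y (col_family T l Y).
Proof.
elim: m T l Y => [|m IH] T l Y //=; split.
- move=> s; exists [set x | follows l (val s) (b x)] => //.
  exact: (usigma_unif (usigma_follows l (val s))).
- by move=> s s0; apply/seteqP; split=> [x []//|x Yx]; split=> //=; rewrite s0.
- by move=> s s' pre x [Yx] /(follows_prefix pre).
- by move=> s; exact: IH.
Qed.

Lemma determines_col k m (T : itree k m) l Y A :
  (forall x, Y x -> A x = col T l (b x)) ->
  determines Y (col_family T l Y) A.
Proof.
elim: m T l Y => [|m IH] T l Y YA //= s; apply: IH => x.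
by move=> /tilde_follow_set[/YA -> /= ->].
Qed.

Lemma col_eff_class k (T : tree_omega k) :
  eff_class beta T (fun x => col (tagged T) 0 (b x)).
Proof.
exists (col_family (tagged T) 0 setT); first exact: is_family_col.
exact: determines_col.
Qed.

End EffectiveFamilies.

(** From level [l] on, the partition sees a tape only through its tokens and moves of level [l],
    because all later levels are built from these tokens. With levels 1 and 0 this is the interface
    to jump inversion. *)
Lemma col_shift k m (T : itree k m) l l' x x' :
  (forall c, emits l c x <-> emits l' c x') ->
  (forall r i, moves l r i x <-> moves l' r i x') ->
  col T l x = col T l' x'.
Proof.
elim: m T l l' => [|m IH] T l l' He Hm //=.
have Hf s : follows l s x <-> follows l' s x'.
  by split=> H r /H/Hm.
have -> : node T l x = node T l' x'.
  apply: node_eq; first exact/Hf/node_follows.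
  move=> s pre ne /Hf/node_max pre'; move/eqP: ne; apply; apply/val_inj.
  exact: prefix_antisym.
have Hg P : forall n, greatest (fun n => emits l (P n) x) n <->
    greatest (fun n => emits l' (P n) x') n.
  by move=> n; split; apply: eq_greatest => j; rewrite He.
apply: IH => [c|r i] /=.
  by split=> -[r /Hg H]; exists r.
by split=> -[n /Hg H]; exists n.
Qed.

(** * Jump inversion *)

Definition tape_open (S : set tape) : Prop := forall x, S x ->
  exists n, forall y : tape, (forall i, i < n -> y i = x i) -> S y.

Lemma wp_inj r t r' t' : wp r t = wp r' t' -> r = r' /\ t = t'.
Proof.
move=> [/double_inj E]; move: (congr1 pfst E) (congr1 psnd E).
by rewrite !pfstK !psndK.
Qed.

Lemma tp_inj c j c' j' : tp c j = tp c' j' -> c = c' /\ j = j'.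
Proof.
move=> /double_inj E; move: (congr1 pfst E) (congr1 psnd E).
by rewrite !pfstK !psndK.
Qed.

Lemma wp_tp r t c j : wp r t <> tp c j.
Proof. by rewrite /wp /tp; lia. Qed.

Lemma leq_tp1 c j : c <= tp c j.
Proof. by have := leq_pr1 c j; rewrite /tp; lia. Qed.

Lemma leq_tp2 c j : j <= tp c j.
Proof. by have := leq_pr2 c j; rewrite /tp; lia. Qed.

Lemma leq_wp2 r t : t <= wp r t.
Proof. by have := leq_pr2 r t; rewrite /wp; lia. Qed.

Lemma ltn_wp r t t' : t < t' -> wp r t < wp r t'.
Proof. by move=> /(ltn_pr r); rewrite /wp; lia. Qed.

(* A forcing condition: bits below [clen] are those of [cval], and from then
   on the bits at positions in [cforb] are 0. *)
Record cond := Cond { cval : tape; clen : nat; cforb : set nat }.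

Definition agrees (p : cond) : set tape :=
  [set z | forall i, i < clen p -> z i = cval p i].

Definition allowed (p : cond) : set tape :=
  [set z | agrees p z /\ forall i, clen p <= i -> cforb p i -> z i = false].

Definition least (p : cond) : tape := fun i => (i < clen p) && cval p i.

Definition refine (p : cond) (z : tape) m := Cond z (maxn m (clen p)) (cforb p).

Lemma least_allowed p : allowed p (least p).
Proof.
split=> i; rewrite /least; first by move=> ->.
by rewrite leqNgt => /negbTE ->.
Qed.

Lemma agrees_refine p z m : allowed p z -> agrees (refine p z m) `<=` agrees p.
Proof.
move=> [az _] w aw i ip; rewrite -az // aw //=.
exact: leq_trans ip (leq_maxr _ _).
Qed.

Lemma allowed_refine p z m : allowed p z -> allowed (refine p z m) `<=` allowed p.
Proof.
move=> pz w [aw fw]; split=> [|i pi fi]; first exact: agrees_refine aw.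
case: (ltnP i (clen (refine p z m))) => [lt|/fw]; last exact.
by rewrite aw //= pz.2.
Qed.

Lemma allowed_bit p i : clen p <= i -> ~ cforb p i ->
  allowed p (fun j => (j == i) || least p j).
Proof.
have [al fl] := least_allowed p.
move=> pi fi; split=> j pj; first by rewrite al // ltn_eqF // (leq_trans pj).
by move=> fj; rewrite fl // orbF; apply/eqP => ji; apply: fi; rewrite -ji.
Qed.

Lemma force_bit p i : clen p <= i -> ~ cforb p i -> exists p',
  [/\ allowed p' `<=` allowed p, cforb p' = cforb p &
      forall z, allowed p' z -> z i].
Proof.
move=> pi fi; have az := allowed_bit pi fi.
exists (refine p (fun j => (j == i) || least p j) i.+1); split=> //.
  exact: allowed_refine.
by move=> z [a _]; rewrite a /= ?eqxx //; exact: leq_maxl.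
Qed.

Lemma decide p (O : set tape) : tape_open O -> exists p',
  [/\ allowed p' `<=` allowed p, cforb p' = cforb p &
      allowed p' `<=` O \/ allowed p' `<=` ~` O].
Proof.
move=> oO; case: (pselect (exists2 z, allowed p z & O z)) => [[z pz Oz]|no].
  have [n nO] := oO z Oz; exists (refine p z n); split=> //.
    exact: allowed_refine.
  left=> w [aw _]; apply: nO => i lt; apply: aw => /=.
  exact: leq_trans lt (leq_maxl _ _).
by exists p; split=> //; right=> z pz Oz; apply: no; exists z.
Qed.

(** * Settling tracks and one stage of the construction *)

Definition track_max rho v : set tape :=
  [set z | greatest (fun n => emits 0 (pr rho n) z) v].

(* [fr] records the tracks whose greatest emitted token is settled. *)
Definition settles (p : cond) (fr : nat -> option nat) : Prop :=
  [/\ forall rho v, fr rho = Some v -> allowed p `<=` track_max rho v,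
      forall rho, fr rho = None -> forall n j, ~ cforb p (tp (pr rho n) j) &
      exists B, forall rho, B <= rho -> fr rho = None].

Lemma settles_mono p p' fr : allowed p' `<=` allowed p -> cforb p' = cforb p ->
  settles p fr -> settles p' fr.
Proof.
by move=> pp ff [H1 H2 H3]; split=> // [rho v /H1 H z /pp/H //|]; rewrite ff.
Qed.

Lemma force_token p fr rho m : settles p fr -> fr rho = None ->
  exists p', [/\ allowed p' `<=` allowed p, cforb p' = cforb p &
    exists2 n, m <= n & allowed p' `<=` emits 0 (pr rho n)].
Proof.
(* Repetition number [clen p] puts the token at a position not below [clen p], where the bit is
   still free. *)
move=> [_ H _] /H{}H; have [p' [pp ff bp]] := force_bit (leq_tp2 _ _) (H m (clen p)).
exists p'; split=> //.
by exists m => // z /bp; exists (clen p).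
Qed.

Lemma force_tokens p fr m b : settles p fr ->
  exists p', [/\ allowed p' `<=` allowed p, cforb p' = cforb p &
    forall rho, rho < b -> fr rho = None ->
    exists2 n, m <= n & allowed p' `<=` emits 0 (pr rho n)].
Proof.
move=> pfr; elim: b => [|b [p1 [pp1 ff1 H1]]]; first by exists p; split=> // z; rewrite ltn0.
have pfr1 := settles_mono pp1 ff1 pfr.
case frb: (fr b) => [v|].
  exists p1; split=> // rho; rewrite ltnS leq_eqVlt => /predU1P[->|]; last exact: H1.
  by rewrite frb.
have [p2 [pp2 ff2 H2]] := force_token m pfr1 frb.
exists p2; split; [exact: subset_trans pp1|by rewrite ff2|move=> rho].
rewrite ltnS leq_eqVlt => /predU1P[->//|rb /(H1 _ rb)[n mn Hn]].
by exists n => // z /pp2/Hn.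
Qed.

(** The track gets the token [v], and all larger ones are forbidden. A prohibition acts only from
    [clen p] on, so no larger token may sit below: its position bounds both the track and the token,
    hence it suffices that [rho] or [v] is at least [clen p]. *)
Lemma settle p fr rho v : settles p fr -> fr rho = None ->
  clen p <= rho \/ clen p <= v ->
  exists2 p', allowed p' `<=` allowed p &
    settles p' (fun s => if s == rho then Some v else fr s).
Proof.
move=> [H1 H2 [B HB]] frN big.
pose new := [set i | exists n j, v < n /\ i = tp (pr rho n) j].
pose p0 := Cond (cval p) (clen p) (cforb p `|` new).
have p0p : allowed p0 `<=` allowed p.
  by move=> z [az fz]; split=> // i pi fi; apply: fz => //; left.
have nf : ~ cforb p0 (tp (pr rho v) (clen p)).
  case; first exact: H2.
  case=> n [j [vn /tp_inj[/(congr1 psnd)]]]; rewrite !psndK => E.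
  by rewrite E ltnn in vn.
have [p' [pp0 ff bp]] := force_bit (leq_tp2 _ _) nf.
exists p'; first by move=> z /pp0/p0p.
split.
- move=> s w; case: eqP => [-> [<-]|_ /H1 H]; last by move=> z /pp0/p0p/H.
  move=> z p'z; split; first by exists (clen p); exact: bp.
  case=> j [s' zs]; have [_ /(_ _ _ _) fz] := pp0 _ p'z.
  move: zs; rewrite fz //=.
    apply: leq_trans (leq_tp1 _ _).
    case: big => big; apply: leq_trans big _; first exact: leq_pr1.
    by apply: leq_trans (leq_pr2 _ _); lia.
  by right; exists (v + j).+1, s'; split=> //; rewrite ltnS leq_addr.
- move=> s; case: eqP => // ne frs n j; rewrite ff /= => -[|]; first exact: H2.
  case=> n' [j' [_ /tp_inj[/(congr1 pfst)]]]; rewrite !pfstK => E _.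
  exact: ne.
- exists (maxn B rho.+1) => s; rewrite geq_max => /andP[/HB -> lt].
  by rewrite gtn_eqF.
Qed.

Definition new_settled (s : nat) (rho v : nat) : Prop :=
  (exists r t, [/\ s = wp r t, rho = r.*2 & pfst v = pfst t]) \/
  (exists r j, s = tp v j /\ rho = r.*2.+1).

Definition settled_after (s : nat) (bit : bool) (fr fr' : nat -> option nat) :=
  [/\ forall rho v, fr rho = Some v -> fr' rho = Some v,
      forall rho v, fr' rho = Some v -> fr rho = Some v \/
        [/\ bit, fr rho = None & new_settled s rho v],
      forall r t, bit -> s = wp r t -> exists v, fr' r.*2 = Some v &
      forall c j, bit -> s = tp c j -> exists r, fr' r.*2.+1 = Some c].

Lemma settle_bit p fr s bit : settles p fr -> exists p' fr',
  [/\ allowed p' `<=` allowed p, settles p' fr' & settled_after s bit fr fr'].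
Proof.
move=> pfr; case: bit; last first.
  by exists p, fr; split=> //; split=> // *; left.
case os: (odd s).
  pose r := pfst s./2; pose t := psnd s./2.
  have sE : s = wp r t by rewrite /wp prK -[LHS]odd_double_half os.
  case frr: (fr r.*2) => [v|].
    exists p, fr; split=> //; split=> // [*|r' t' _|c j _].
    - by left.
    - by rewrite sE => /wp_inj[<- _]; exists v.
    - by rewrite sE => /wp_tp.
  (* The track is prescribed here, so the token has to be large: the padding [clen p] achieves this
     without changing the move [pfst t]. *)
  have [p' pp pfr'] := settle (v := pr (pfst t) (clen p)) pfr frr
    (or_intror (leq_pr2 _ _)).
  exists p', (fun s => if s == r.*2 then Some (pr (pfst t) (clen p)) else fr s).
  split=> //; split.
  - by move=> rho v; case: eqP => // ->; rewrite frr.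
  - move=> rho v; case: eqP => [-> [<-]|]; last by left.
    by right; split=> //; left; exists r, t; rewrite pfstK.
  - by move=> r' t' _; rewrite sE => /wp_inj[<- _]; rewrite eqxx; eexists.
  - by move=> c j _; rewrite sE => /wp_tp.
pose c := pfst s./2; pose j := psnd s./2.
have sE : s = tp c j by rewrite /tp prK -[LHS]odd_double_half os.
(* Here the token [c] is prescribed, so the track has to be large; beyond [B] it is also
   unsettled. *)
have [_ _ [B HB]] := pfr; pose r := maxn B (clen p).
have frr : fr r.*2.+1 = None.
  by apply: HB; have := leq_maxl B (clen p); rewrite -/r; lia.
have [p' pp pfr'] : exists2 p', allowed p' `<=` allowed p &
    settles p' (fun s => if s == r.*2.+1 then Some c else fr s).
  by apply: settle => //; left; have := leq_maxr B (clen p); rewrite -/r; lia.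
exists p', (fun s => if s == r.*2.+1 then Some c else fr s).
split=> //; split.
- by move=> rho v; case: eqP => // ->; rewrite frr.
- move=> rho v; case: eqP => [-> [<-]|]; last by left.
  by right; split=> //; right; exists r, j.
- by move=> r' t' _; rewrite sE => /esym/wp_tp.
- by move=> c' j' _; rewrite sE => /tp_inj[<- _]; exists r; rewrite eqxx.
Qed.

(** The clause [s < clen p'] makes the limit tape total. The last clause gives arbitrarily large
    tokens to every track that is never settled, so that such a track has no greatest token. *)
Definition stage_spec (O : set tape) s bit p fr p' fr' : Prop :=
  [/\ allowed p' `<=` allowed p, settles p' fr', s < clen p' &
      settled_after s bit fr fr'] /\
  [/\ allowed p' `<=` O \/ allowed p' `<=` ~` O &
      forall rho, rho < s -> fr' rho = None ->
      exists2 n, s <= n & allowed p' `<=` emits 0 (pr rho n)].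

Lemma stage (O : set tape) s bit p fr : tape_open O -> settles p fr ->
  exists p' fr', stage_spec O s bit p fr p' fr'.
Proof.
move=> oO pfr.
have [p1 [fr' [pp1 pfr1 fr'P]]] := settle_bit s bit pfr.
have [p2 [pp2 ff2 H2]] := force_tokens s s pfr1.
have [p3 [pp3 ff3 H3]] := decide p2 oO.
pose p4 := refine p3 (least p3) s.+1.
have pp4 : allowed p4 `<=` allowed p3 by exact/allowed_refine/least_allowed.
have pp42 : allowed p4 `<=` allowed p2 by exact: subset_trans pp3.
have pp41 : allowed p4 `<=` allowed p1 by exact: subset_trans pp2.
exists p4, fr'; split; split=> //.
- exact: subset_trans pp1.
- apply: settles_mono pfr1 => //=.
  by rewrite ff3 ff2.
- by rewrite /= leq_maxl.
- by case: H3 => H3; [left|right]; exact: subset_trans H3.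
- move=> rho rs /(H2 _ rs)[n sn Hn]; exists n => //.
  exact: subset_trans Hn.
Qed.

(* Friedberg jump inversion: level 1 of [h y] is a copy of level 0 of [y], and
   [h] makes countably many prescribed open sets clopen. *)
Lemma jump_inversion (O : nat -> set tape) p0 :
  (forall s, tape_open (O s)) -> (forall c j, ~ cforb p0 (tp c j)) ->
  exists h : tape -> tape,
    [/\ forall s, tape_open (h @^-1` O s) /\ tape_open (h @^-1` (~` O s)),
        forall y, allowed p0 (h y),
        forall y c, emits 1 c (h y) <-> emits 0 c y &
        forall y r i, moves 1 r i (h y) <-> moves 0 r i y].
Proof.
move=> oO nf0; pose state := (cond * (nat -> option nat))%type.
(* The next state is chosen as a function of the stage, one bit and the old state, so that the state
   at stage [s] depends on [y] only below [s]. *)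
have /choice[F FP] : forall a : nat * bool * state, exists b : state,
    settles a.2.1 a.2.2 ->
    stage_spec (O a.1.1) a.1.1 a.1.2 a.2.1 a.2.2 b.1 b.2.
  move=> -[[s bit] [p fr]] /=.
  case: (pselect (settles p fr)) => [pfr|]; last by exists (p, fr).
  have [p' [fr' H]] := stage s bit (oO s) pfr.
  by exists (p', fr').
pose st (y : tape) := fix st s : state :=
  if s is s'.+1 then F (s', y s', st s') else (p0, fun=> None).
have stS y s : st y s.+1 = F (s, y s, st y s) by [].
have stv y s : settles (st y s).1 (st y s).2.
  elim: s => [|s IH]; last by rewrite stS; have [[]] := FP (s, y s, st y s) IH.
  by split=> //; exists 0.
have spec y s : stage_spec (O s) s (y s) (st y s).1 (st y s).2
    (st y s.+1).1 (st y s.+1).2 := FP (s, y s, st y s) (stv y s).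
have st_eq y y' s : (forall i, i < s -> y i = y' i) -> st y s = st y' s.
  elim: s => // s IH yy; rewrite !stS yy // IH // => i is_.
  exact/yy/ltnW.
pose h (y : tape) : tape := fun i => cval (st y i.+1).1 i.
have dec y s s' : s <= s' -> allowed (st y s').1 `<=` allowed (st y s).1.
  elim: s' => [|s' IH]; first by rewrite leqn0 => /eqP ->.
  rewrite leq_eqVlt ltnS => /predU1P[->//|/IH]; apply: subset_trans.
  by have [[]] := spec y s'.
have hP y s : allowed (st y s).1 (h y).
  (* Both clauses of [allowed] are bitwise, so the comparison tape may vary with [i]. *)
  have key i : exists2 z, allowed (st y s).1 z & z i = h y i.
    exists (least (st y (maxn s i.+1)).1).
      exact: dec (leq_maxl _ _) _ (least_allowed _).
    have [a _] := dec y i.+1 _ (leq_maxr s i.+1) _ (least_allowed _).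
    by apply: a; have [[_ _ ? _] _] := spec y i.
  split=> i; first by move=> ip; have [z [az _] <-] := key i; exact: az.
  by move=> pi fi; have [z [_ fz] <-] := key i; exact: fz.
have frM y s s' rho v : s <= s' -> (st y s).2 rho = Some v ->
    (st y s').2 rho = Some v.
  elim: s' => [|s' IH]; first by rewrite leqn0 => /eqP ->.
  rewrite leq_eqVlt ltnS => /predU1P[->//|/IH{}IH /IH].
  by have [[_ _ _ [H _ _ _]] _] := spec y s'; exact: H.
have trackP y rho v : track_max rho v (h y) <-> exists s, (st y s).2 rho = Some v.
  have settledP s v' : (st y s).2 rho = Some v' -> track_max rho v' (h y).
    by move=> E; have [H _ _] := stv y s; exact: H E _ (hP y s).
  split=> [Hv|[s /settledP //]]; apply: contrapT => no.
  pose s := maxn rho.+1 v.+1.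
  case E: ((st y s.+1).2 rho) => [v'|].
    apply: no; exists s.+1; rewrite E; congr Some.
    exact: greatest_uniq (settledP _ _ E) Hv.
  have [_ [_ /(_ rho (leq_maxl _ _) E)[n sn Hn]]] := spec y s.
  have vn : v < n by apply: leq_trans sn; exact: leq_maxr.
  apply: Hv.2; exists (n - v.+1); rewrite -addSn subnKC //.
  exact/Hn/hP.
(* Positions in a row increase with [t], so an earlier 1 of the row would have settled the track at
   an earlier stage. The track thus records the first 1, as [moves 0] does. *)
have evenP y s r v : (st y s).2 r.*2 = Some v -> exists t,
    [/\ y (wp r t), pfst v = pfst t & forall t', t' < t -> ~~ y (wp r t')].
  elim: s => // s IH; have [[_ _ _ [_ H _ _]] _] := spec y s.
  case/H => [/IH //|[ys frN [[r' [t [sE rr vt]]]|[r' [j [_]]]]]]; last by lia.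
  have E : r' = r by lia.
  rewrite {r' rr}E in sE; exists t; split; [by rewrite -sE|by []|].
  move=> t' tt; apply/negP => yt'.
  have [[_ _ _ [_ _ H' _]] _] := spec y (wp r t').
  have [v' Ev'] := H' r t' yt' erefl.
  have : (st y s).2 r.*2 = Some v'.
    by apply: frM Ev'; rewrite sE; exact: ltn_wp.
  by rewrite frN.
have oddP y s r c : (st y s).2 r.*2.+1 = Some c -> exists j, y (tp c j).
  elim: s => // s IH; have [[_ _ _ [_ H _ _]] _] := spec y s.
  case/H => [/IH //|[ys _ [[r' [t [_]]]|[r' [j [sE _]]]]]]; first by lia.
  by exists j; rewrite -sE.
exists h; split.
- move=> s.
  (* The condition reached after stage [s] decides [O s], and it depends only on the bits of [y] up
     to [s]. *)
  have hO y y' : (forall i, i < s.+1 -> y' i = y i) -> O s (h y) -> O s (h y').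
    move=> /st_eq E Oy; have [_ [[sub|sub] _]] := spec y s.
      by apply: sub; rewrite -E; exact: hP.
    by have := sub _ (hP y s.+1).
  split=> y Oy; exists s.+1 => y' E; first exact: hO Oy.
  by move=> Oy'; apply: Oy; apply: hO Oy' => i /E.
- by move=> y; exact: hP y 0.
- move=> y c; split=> [[r /trackP[s /oddP //]]|[j yj]].
  have [[_ _ _ [_ _ _ H]] _] := spec y (tp c j).
  have [r Er] := H c j yj erefl.
  by exists r; apply/trackP; exists (tp c j).+1.
- move=> y r i; split.
    case=> n /trackP[s /evenP[t [yt]]]; rewrite pfstK => it mt.
    by exists (psnd t); rewrite it prK.
  case=> n [yn mn]; have [[_ _ _ [_ _ H _]] _] := spec y (wp r (pr i n)).
  have [v Ev] := H r _ yn erefl.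
  have [t [yt vt mt]] := evenP _ _ _ _ Ev.
  have tE : t = pr i n.
    case: (ltngtP t (pr i n)) => // [/mn|/mt]; first by rewrite yt.
    by rewrite yn.
  exists (psnd v); apply/trackP; exists (wp r (pr i n)).+1.
  by have -> : pr i (psnd v) = v by rewrite -[RHS]prK vt tE pfstK.
Qed.

(** * Boldface families on tapes *)

Fixpoint tape_sigma0 n : set (set tape) :=
  match n with
  | 0 => [set S | tape_open S]
  | n'.+1 => [set S | exists F G : nat -> set tape,
      [/\ forall j, tape_sigma0 n' (F j), forall j, tape_sigma0 n' (G j) &
          S = \bigcup_j (F j `\` G j)]]
  end.

Lemma tape_open_bigcup I (D : set I) (F : I -> set tape) :
  (forall i, D i -> tape_open (F i)) -> tape_open (\bigcup_(i in D) F i).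
Proof.
move=> oF x [i Di /(oF i Di)[n H]]; exists n => y /H Fy; by exists i.
Qed.

Lemma tape_openI S S' : tape_open S -> tape_open S' -> tape_open (S `&` S').
Proof.
move=> oS oS' x [/oS[n H] /oS'[n' H']]; exists (maxn n n') => y yx.
split; [apply: H|apply: H'] => i lt; apply: yx; apply: leq_trans lt _.
  exact: leq_maxl.
exact: leq_maxr.
Qed.

Lemma tape_openT : tape_open setT.
Proof. by exists 0. Qed.

Lemma tape_sigma0T n : tape_sigma0 n setT.
Proof.
suff [] : tape_sigma0 n set0 /\ tape_sigma0 n setT by [].
elim: n => [|n [IH0 IHT]] /=; first by split; [|exact: tape_openT].
split; [exists (fun=> set0), (fun=> set0)|exists (fun=> setT), (fun=> set0)].
  by split=> //; apply/seteqP; split=> [x|x [j _ [[]]]].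
by split=> //; apply/seteqP; split=> // x _; exists 0 => //; split=> // -[].
Qed.

(** Jump inversion needs its open sets before it yields [h]. This isolates the properties of [h]
    that are guaranteed by making some countable list of open sets clopen. *)
Definition countably_controlled (R : (tape -> tape) -> Prop) : Prop :=
  exists2 O : nat -> set tape, forall s, tape_open (O s) &
    forall h : tape -> tape, (forall s, tape_open (h @^-1` O s) /\
      tape_open (h @^-1` (~` O s))) -> R h.

Lemma controlled_all (I : countType) (R : I -> (tape -> tape) -> Prop) :
  (forall i, countably_controlled (R i)) ->
  countably_controlled (fun h => forall i, R i h).
Proof.
move=> RP.
have /choice[O OP] : forall i, exists O : nat -> set tape,
    (forall s, tape_open (O s)) /\
    forall h : tape -> tape, (forall s, tape_open (h @^-1` O s) /\
      tape_open (h @^-1` (~` O s))) -> R i h.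
  by move=> i; have [O] := RP i; exists O.
exists (fun n => if (choice.unpickle n : option (I * nat)) is Some (i, s)
  then O i s else setT).
  move=> n; case: choice.unpickle => [[i s]|]; last exact: tape_openT.
  exact: (OP i).1.
move=> h H i; apply: (OP i).2 => s.
by have := H (choice.pickle (i, s)); rewrite choice.pickleK.
Qed.

Lemma controlled_and R R' : countably_controlled R -> countably_controlled R' ->
  countably_controlled (fun h => R h /\ R' h).
Proof.
move=> c c'; have [|O oO H] := @controlled_all bool (fun b => if b then R else R').
  by case.
by exists O => // h /H Hh; split; [exact: Hh true|exact: Hh false].
Qed.

Lemma controlled_sub (R R' : (tape -> tape) -> Prop) : (forall h, R h -> R' h) ->
  countably_controlled R -> countably_controlled R'.
Proof. by move=> RR [O oO H]; exists O => // h /H/RR. Qed.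

(** At the bottom the differences [F j] minus [G j] pull back to open sets, as each [G j] becomes
    clopen; this saves one level. Above, preimages commute with unions and differences. *)
Lemma sigma0_controlled n S : tape_sigma0 n.+1 S ->
  countably_controlled (fun h => tape_sigma0 n (h @^-1` S)).
Proof.
elim: n S => [|n IH] S [F [G [sF sG ->]]].
  have cF : countably_controlled (fun h => forall j, tape_open (h @^-1` F j)).
    by exists F => // h H j; have [] := H j.
  have cG : countably_controlled (fun h => forall j, tape_open (h @^-1` (~` G j))).
    by exists G => // h H j; have [] := H j.
  apply: controlled_sub (controlled_and cF cG) => h [HF HG].
  rewrite -[h @^-1` _]/(\bigcup_j (h @^-1` F j `&` h @^-1` (~` G j))).
  by apply: tape_open_bigcup => j _; exact: tape_openI.
have cF := controlled_all (fun j => IH _ (sF j)).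
have cG := controlled_all (fun j => IH _ (sG j)).
apply: controlled_sub (controlled_and cF cG) => h [HF HG].
by exists (fun j => h @^-1` F j), (fun j => h @^-1` G j).
Qed.

Fixpoint pull (X X' : Type) (g : X -> X') k m :
    forall T : itree k m, Defs.family X' T -> Defs.family X T :=
  match m with
  | 0 => fun _ F => F
  | m'.+1 => fun T F => (fun s => g @^-1` F.1 s, fun s => pull g (F.2 s))
  end.

Lemma determines_pull (X X' : Type) (g : X -> X') k m (T : itree k m) Y
    (F : Defs.family X' T) (A : X' -> kbar k) :
  determines Y F A -> determines (g @^-1` Y) (pull g F) (A \o g).
Proof.
elim: m T Y F => [|m IH] T Y F /=; first by move=> H x; exact: H.
by move=> H s; exact: IH (H s).
Qed.

Lemma is_family_pull (X X' : Type) (g : X -> X')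
    (L : nat -> set (set X)) (L' : nat -> set (set X')) k m (T : itree k m)
    n Y (F : Defs.family X' T) :
  (forall j S, L' j S -> L j (g @^-1` S)) ->
  is_family L' n Y F -> is_family L n (g @^-1` Y) (pull g F).
Proof.
move=> LL; elim: m T n Y F => [|m IH] T n Y F //= [H1 H2 H3 H4]; split.
- by move=> s; have [S LS <-] := H1 s; exists (g @^-1` S) => //; exact: LL.
- by move=> s /H2 ->.
- by move=> s s' /H3 H x /H.
- by move=> s; exact: IH (H4 s).
Qed.

Lemma family_controlled k m (T : itree k m) n Y (F : Defs.family tape T) :
  is_family tape_sigma0 n.+1 Y F ->
  countably_controlled (fun h => is_family tape_sigma0 n (h @^-1` Y) (pull h F)).
Proof.
elim: m T n Y F => [|m IH] T n Y F /=.
  by exists (fun=> setT) => // *; exact: tape_openT.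
move=> [H1 H2 H3 H4].
have cU : countably_controlled (fun h => forall s : dom T,
    trace (tape_sigma0 n) (h @^-1` Y) (h @^-1` F.1 s)).
  apply: controlled_all => s; have [S LS <-] := H1 s.
  apply: controlled_sub (sigma0_controlled LS) => h HS.
  by exists (h @^-1` S).
have cF := controlled_all (fun s : dom T => IH _ _ _ _ (H4 s)).
apply: controlled_sub (controlled_and cU cF) => h [HU HF]; split=> //.
- by move=> s /H2 ->.
- by move=> s s' /H3 H x /H.
Qed.

(** * Finite extension along the nodes of a tree *)

Definition walker_bits d : set nat := [set i | exists r t, d <= r /\ i = wp r t].

(** Rows from [size s] on are empty, below [clen p] by the values and beyond by prohibition, so
    allowed tapes halt at [s]. The path is required of all agreeing tapes, because a step to a child
    breaks the prohibition. *)
Definition stays (p : cond) (s : seq nat) : Prop :=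
  [/\ cforb p = walker_bits (size s),
      forall z, agrees p z -> follows 0 s z &
      forall r t, size s <= r -> wp r t < clen p -> cval p (wp r t) = false].

Lemma stays_halted p s z r t : stays p s -> allowed p z -> size s <= r ->
  z (wp r t) = false.
Proof.
move=> [Np _ cp] [az fz] sr; case: (ltnP (wp r t) (clen p)) => lt.
  by rewrite az // cp.
by apply: fz => //; rewrite Np; exists r, t.
Qed.

Lemma prefix_neq_size (s s' : seq nat) : prefix s s' -> s != s' -> size s < size s'.
Proof.
move=> ss' ne; rewrite ltn_neqAle size_prefix // andbT.
apply: contra ne => /eqP E; move: ss'; rewrite prefixE E take_size.
by rewrite eq_sym.
Qed.

Lemma stays_node (A : Type) (T : qtree A) p (s : dom T) z :
  stays p (val s) -> allowed p z -> node T 0 z = s.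
Proof.
move=> ps pz; apply: node_eq.
  by have [_ H _] := ps; apply: H; case: pz.
move=> s' pre ne /(_ (size (val s))).
case; first by apply: prefix_neq_size.
by move=> n []; rewrite (stays_halted _ ps pz).
Qed.

Lemma stays_refine p s z m : stays p s -> allowed p z -> stays (refine p z m) s.
Proof.
move=> ps pz; have [Np fp _] := ps; split=> // [w /(agrees_refine pz)/fp //|].
by move=> r t sr _; exact: stays_halted ps pz sr.
Qed.

Lemma stays_child p s i : stays p s ->
  exists2 p', stays p' (rcons s i) & agrees p' `<=` agrees p.
Proof.
(* The padding [clen p] puts the first 1 of row [d] beyond the string already fixed. *)
move=> ps; pose d := size s; pose t := pr i (clen p).
pose p' := Cond (fun j => (j == wp d t) || least p j) (wp d t).+1 (walker_bits d.+1).
have lt : clen p <= wp d t by exact: leq_trans (leq_pr2 _ _) (leq_wp2 _ _).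
have lw r t' : d <= r -> least p (wp r t') = false.
  by move=> dr; exact: stays_halted ps (least_allowed p) dr.
have sub : agrees p' `<=` agrees p.
  move=> z az j jp; have [al _] := least_allowed p.
  rewrite az /=; last by rewrite ltnS ltnW // (leq_trans jp).
  by rewrite al // ltn_eqF // (leq_trans jp).
have [_ fp _] := ps; exists p' => //; split; first by rewrite size_rcons.
- move=> z az; apply/follows_rcons; split; first exact/fp/sub.
  exists (clen p); split; first by rewrite az /= ?eqxx.
  move=> t' tt; have tt' : wp d t' < wp d t by exact: ltn_wp.
  rewrite az /=; last by rewrite ltnS ltnW.
  by rewrite ltn_eqF //= lw.
- move=> r t'; rewrite size_rcons => sr _ /=; rewrite lw ?(ltnW sr) // orbF.
  by apply/eqP => /wp_inj[E _]; rewrite E ltnn in sr.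
Qed.

Section Stabilize.
Variables (D : {fset seq nat}) (U : D -> set tape).
Hypothesis openU : forall s, tape_open (U s).

(** The inclusion of [agrees p] survives the step to a child of [s] and gives monotonicity; the
    inclusion of [allowed p] places the tapes halted at [s] in the single component of [v]. *)
Definition stable (s : seq nat) (p : cond) (v : D) : Prop :=
  [/\ stays p s, agrees p `<=` U v & allowed p `<=` tilde U v].

(** Take the longest node above [v] whose open set contains a neighbourhood given by an extension of
    [p] that still stays at [s]. If an allowed tape lay in the set of a longer node, a finite part
    of that tape would contradict maximality. *)
Lemma stabilize s p v : stays p s -> allowed p `<=` U v ->
  exists p' v', [/\ stable s p' v', prefix (val v) (val v') & agrees p' `<=` agrees p].
Proof.
move=> ps pv.
pose good_at v' := exists p', [/\ stays p' s, agrees p' `<=` agrees p & agrees p' `<=` U v'].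
have good_refine q w v' : stays q s -> agrees q `<=` agrees p -> allowed q w ->
    U v' w -> good_at v'.
  move=> qs qp qw /openU[n nU]; exists (refine q w n).
  split; [exact: stays_refine|exact: subset_trans (agrees_refine qw) _|].
  move=> z az; apply: nU => i lt; apply: az => /=.
  exact: leq_trans lt (leq_maxl _ _).
have gv : good_at v.
  apply: good_refine ps _ (least_allowed p) _ => //.
  exact/pv/least_allowed.
pose best v' := `[< prefix (val v) (val v') /\ good_at v' >].
have bv : best v by apply/asboolP; split; rewrite ?prefix_refl.
case: (@arg_maxnP _ v best (fun v' => size (val v')) bv) => v' /asboolP[vv'].
move=> [p' [p's p'p p'U]] mx; exists p', v'; split=> //; split=> // z p'z.
split; first by apply: p'U; case: p'z.
case=> w [/= v'w ne] Uw; have /mx : best w.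
  apply/asboolP; split; first exact: prefix_trans v'w.
  exact: good_refine p's p'p p'z Uw.
by rewrite /= leqNgt => /negP; apply; apply: prefix_neq_size => //; apply/eqP => /val_inj.
Qed.

(** The walk follows a string entry by entry, so the states at its prefixes are those met on the
    way, and monotonicity reduces to single steps. *)
Lemma stable_walk v0 : U v0 = setT ->
  exists st : seq nat -> cond * D,
    (forall s, stable s (st s).1 (st s).2) /\
    forall s s', prefix s s' -> prefix (val (st s).2) (val (st s').2).
Proof.
move=> U0; pose p0 := Cond (fun=> false) 0 (walker_bits 0).
have p00 : stays p0 [::] by split.
have [|p1 [v1 [H1 _ _]]] := stabilize p00 (v := v0); first by rewrite U0.
have /choice[G GP] : forall a : (seq nat * (cond * D)) * nat, exists b : cond * D,
    stable a.1.1 a.1.2.1 a.1.2.2 ->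
    stable (rcons a.1.1 a.2) b.1 b.2 /\ prefix (val a.1.2.2) (val b.2).
  move=> [[s [p v]] i] /=.
  case: (pselect (stable s p v)) => [[ps pU _]|]; last by exists (p, v).
  have [p' p's p'p] := stays_child i ps.
  have [|p2 [v2 [H2 vv2 _]]] := stabilize p's (v := v).
    by move=> z [/p'p/pU].
  by exists (p2, v2).
pose walk := foldl (fun x i => (rcons x.1 i, G (x, i))) ([::], (p1, v1)).
have walkS s i : walk (rcons s i) = (rcons (walk s).1 i, G (walk s, i)).
  by rewrite /walk foldl_rcons.
have walk1 s : (walk s).1 = s.
  by elim/last_ind: s => // s i IH; rewrite walkS /= IH.
have H s : stable s (walk s).2.1 (walk s).2.2.
  elim/last_ind: s => [//|s i IH]; rewrite walkS /=.
  by have := GP (walk s, i); rewrite /= walk1 => /(_ IH)[].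
exists (fun s => (walk s).2); split=> // s _ /prefixP[u ->].
elim/last_ind: u => [|u i IH]; first by rewrite cats0 prefix_refl.
rewrite -rcons_cat walkS; apply: prefix_trans IH _.
by have := GP (walk (s ++ u), i); rewrite /= walk1 => /(_ (H _))[].
Qed.

End Stabilize.

Lemma itree_le_of_family k m (T V : itree k m) (F : Defs.family tape V) :
  is_family tape_sigma0 0 setT F -> determines setT F (col T 0) -> itree_le T V.
Proof.
(* Between colors, any one tape gives the equality. *)
elim: m T V F => [|m IH] T V F /=; first by move=> _ /(_ (fun=> false) I).
move=> [H1 H2 _ H4] HA.
have oU s : tape_open (F.1 s) by have [S oS <-] := H1 s; rewrite setTI.
have [st [stP stM]] := stable_walk oU (H2 (tree_root V) erefl).
exists (fun s => (st (val s)).2); split; first by move=> s s'; exact: stM.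
move=> s; set v := (st (val s)).2; have [ps _ pv] := stP (val s).
have [O oO HO] := family_controlled (H4 v).
(* Halting forbids only odd positions, so all token positions remain at the disposal of jump
   inversion. *)
have nf c j : ~ cforb (st (val s)).1 (tp c j).
  by have [-> _ _] := ps; case=> r [t [_ /esym/wp_tp]].
have [h [hO hp he hm]] := jump_inversion oO nf.
(* All values of [h] halt at [s] and lie in the component of [v]. The family on this component thus
   pulls back to one on all tapes, one level lower, which determines the partition of the label of
   [s]. *)
have hT : h @^-1` tilde F.1 v = setT.
  by apply/seteqP; split=> // y _; exact/pv/hp.
have := HO h hO; rewrite hT => fam; apply: IH fam _.
have := determines_pull h (HA v); rewrite hT.
congr determines; apply/funext => y /=.
rewrite (stays_node ps (hp y)); exact: col_shift.
Qed.

(** * Comparison of levels and spaces *)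

Lemma node_map (A B : Type) (g : A -> B) (T : qtree A) l x :
  node (qtree_map g T) l x = node T l x.
Proof.
apply: node_eq; first exact: (@node_follows _ T).
move=> s pre ne /(@node_max _ T) pre'; move/eqP: ne; apply; apply/val_inj.
exact: prefix_antisym.
Qed.

Lemma col_up k m (T : itree k m) l x : col (itree_up T) l x = col T l x.
Proof. by elim: m T l => [//|m IH] T l /=; rewrite node_map; exact: IH. Qed.

Lemma col_emb k m p (le_mp : m <= p) (T : itree k m) l x :
  col (itree_emb le_mp T) l x = col T l x.
Proof.
rewrite /itree_emb; move: (p - m) (subnK le_mp) => d e.
case: p / e {le_mp}.
by elim: d => // d IH; exact: etrans (col_up _ _ _) IH.
Qed.

Section LiftFamilies.
Variables (X : Type) (k : option nat) (L : nat -> set (set X)).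
Hypothesis LT : forall n, L n setT.

(** Lifting replaces each color by a one-node tree, whose only set is the ambient [Y], the trace of
    the whole space. *)
Fixpoint up_family m :
    forall T : itree k m, set X -> Defs.family X T -> Defs.family X (itree_up T) :=
  match m with
  | 0 => fun _ Y _ => (fun _ => Y, fun _ => tt)
  | m'.+1 => fun T Y F => (F.1, fun s => up_family (tilde F.1 s) (F.2 s))
  end.

Lemma is_family_up m (T : itree k m) n Y (F : Defs.family X T) :
  is_family L n Y F -> is_family L n Y (up_family Y F).
Proof.
elim: m T n Y F => [|m IH] T n Y F /=.
  move=> _; split=> //; last by move=> s s' _ x.
  by move=> s; exists setT; rewrite ?setIT.
by case=> H1 H2 H3 H4; split=> // s; exact: IH (H4 s).
Qed.

Lemma determines_up m (T : itree k m) Y (F : Defs.family X T) A :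
  determines Y F A -> determines Y (up_family Y F) A.
Proof.
elim: m T Y F => [|m IH] T Y F /=; first by move=> H s x [/H].
by move=> H s; exact: IH.
Qed.

Lemma family_emb m p (le_mp : m <= p) (T : itree k m) (F : Defs.family X T) n Y A :
  is_family L n Y F -> determines Y F A ->
  exists2 F' : Defs.family X (itree_emb le_mp T),
    is_family L n Y F' & determines Y F' A.
Proof.
move=> HF HA; rewrite /itree_emb; move: (p - m) (subnK le_mp) => d e.
case: p / e {le_mp}.
elim: d => [|d [F' HF' HA']] /=; first by exists F.
by exists (up_family Y F'); [exact: is_family_up|exact: determines_up].
Qed.

End LiftFamilies.

(** The sets containing a cylinder around [x] form a filter that converges to [x] in every
    coordinate, hence in the product. *)
Lemma product_open_cylinder (T : topologicalType)
    (S : set (prod_topology (fun _ : nat => T))) x : open S -> S x ->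
  exists n, forall y, (forall i, i < n -> y i = x i) -> S y.
Proof.
move=> oS Sx.
pose F : set_system (prod_topology (fun _ : nat => T)) :=
  [set A | exists n, forall y, (forall i, i < n -> y i = x i) -> A y].
have FF : Filter F.
  split; first by exists 0.
    move=> A B [n An] [m Bm]; exists (maxn n m) => y yx; split.
      by apply: An => i lt; apply: yx; apply: leq_trans lt (leq_maxl _ _).
    by apply: Bm => i lt; apply: yx; apply: leq_trans lt (leq_maxr _ _).
  by move=> A B AB [n An]; exists n => y /An/AB.
suff : F --> x by apply; apply: open_nbhs_nbhs.
apply/cvg_sup => i A; rewrite nbhsE => -[B [[C oC <-] Cx] BA].
by exists i.+1 => y yx; apply: BA; rewrite /= yx.
Qed.

(** The tapes are a retract of [X]: the lightface partition is read through [b], a boldface family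
    is pulled back along [e], and [b] after [e] is the identity. *)
Lemma noncollapsing_of_bits (X : topologicalType) (beta : nat -> set X)
    (b : X -> tape) (e : tape -> X) k :
  (forall c x, beta c x ->
    map odd (CodeSeq.decode c) = mkseq (b x) (size (CodeSeq.decode c))) ->
  (forall x n, exists2 c, beta c x & n <= size (CodeSeq.decode c)) ->
  cancel e b -> (forall S, open S -> tape_open (e @^-1` S)) ->
  strongly_uniformly_noncollapsing beta k.
Proof.
move=> bits fine eK open_e T /(_ _ (col_eff_class bits fine T)).
have bold_e n S : @bold_sigma0 X n S -> tape_sigma0 n (e @^-1` S).
  elim: n S => [|n IH] S /=; first exact: open_e.
  case=> F [G [sF sG ->]].
  by exists (fun j => e @^-1` F j), (fun j => e @^-1` G j); split=> // j; exact: IH.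
case=> V /= nTV [F famF detF]; apply: nTV; rewrite /tree_le.
have famF' := is_family_pull bold_e famF.
have detF' := determines_pull e detF.
have [F' famF2 detF2] := family_emb tape_sigma0T
  (leq_maxr (tag T) (tag V)) famF' detF'.
apply: itree_le_of_family famF2 _.
move: detF2; congr determines; apply/funext => x /=.
by rewrite eK col_emb.
Qed.

Local Close Scope classical_set_scope.

Theorem theorem6p3 (k : option nat) (hk : if k is Some n then 2 <= n else true) :
  strongly_uniformly_noncollapsing baire_base k /\
  strongly_uniformly_noncollapsing cantor_base k.
Proof.
split.
  (* A point of the Baire space is read by parities, and a tape is included as a sequence of zeros
     and ones. *)
  apply: (@noncollapsing_of_bits baire_space baire_base
    (fun x n => odd (x n)) (fun x n => x n : nat)).
  - move=> c x; rewrite /baire_base /cylinder /= => {1}<-.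
    by rewrite /mkseq -map_comp.
  - move=> x n; exists (CodeSeq.code (mkseq x n)); last first.
      by rewrite CodeSeq.codeK size_mkseq.
    by rewrite /baire_base CodeSeq.codeK /cylinder /= size_mkseq.
  - by move=> x; apply/funext => n; rewrite oddb.
  - move=> S oS x /(product_open_cylinder oS)[n H]; exists n => y yx.
    by apply: H => i /yx ->.
apply: (@noncollapsing_of_bits cantor_space cantor_base id id) => //.
- by move=> c x; rewrite /cantor_base /cylinder /= size_map.
- move=> x n; exists (CodeSeq.code (mkseq (fun i => x i : nat) n)); last first.
    by rewrite CodeSeq.codeK size_mkseq.
  rewrite /cantor_base CodeSeq.codeK /cylinder /= size_map size_mkseq.
  by rewrite /mkseq -map_comp; apply: eq_map => i /=; rewrite oddb.
- move=> S oS x /(product_open_cylinder oS)[n H]; exists n => y yx.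
  exact: H.
Qed.
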